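(* In Zermelo–Fraenkel set theory without the Axiom of Choice, the following two statements are equivalent. (A) (The Baire Category Theorem) For every complete metric space $X$ and every countable collection $\{C_n\}$ of closed subsets of $X$, each with empty interior, the union $\bigcup_n C_n$ has empty interior. (B) For every topological groupoid $G$ such that (1) the unit space $G^{(0)}$ is a complete metric space, and (2) $G$ has a countable cover consisting of neighbourhood bisections: if $G$ is effective, then $G$ is topologically principal.
   Context: A groupoid $G$ is a small category in which every morphism is invertible; $G$ is identified with its set of morphisms. The set of objects is identified with the set of identity morphisms and is denoted $G^{(0)}\subseteq G$ (the unit space). For $\gamma\in G$, $r(\gamma)$ and $s(\gamma)$ denote the range and source of $\gamma$, so $r,s:G\to G^{(0)}\subseteq G$. Put $G^{(2)}:=\{(\gamma,\eta)\in G\times G: r(\eta)=s(\gamma)\}$, the set of composable pairs. For $x\in G^{(0)}$, the isotropy group at $x$ is $xGx:=\{\gamma\in G: r(\gamma)=s(\gamma)=x\}$, and $\operatorname{Iso}(G):=\bigcup_{x\in G^{(0)}} xGx$. For $B\subseteq G$, $\operatorname{Iso}(B):=\operatorname{Iso}(G)\cap B$. A topological groupoid is a groupoid $G$ equipped with a topology so that composition $G^{(2)}\to G$ and inversion $G\to G$ are continuous ($G^{(2)}$ carries the subspace topology from $G\times G$). That $G^{(0)}$ is a complete metric space means that its topology as a subspace of $G$ is the topology of a complete metric. An open set $A\subseteq G$ is an open bisection if $r(A)$ and $s(A)$ are open in $G$ and $r|_A$ and $s|_A$ are homeomorphisms onto their images (in particular, $r$ and $s$ are injective on $A$). Write $\operatorname{Int}(D)$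 for the interior of a set $D\subseteq G$ and $\overline{D}$ for its closure. A set $B\subseteq G$ is a neighbourhood bisection if: (1) $B\subseteq\overline{\operatorname{Int}(B)}$; (2) $r|_B$ and $s|_B$ are injective; (3) $r(B)$ and $s(B)$ are open in $G$; (4) $\operatorname{Int}(B)$ is an open bisection; (5) $B-\operatorname{Int}(B)\subseteq\operatorname{Iso}(B)-G^{(0)}$. $G$ is effective if $\operatorname{Iso}(G)-G^{(0)}$ has empty interior in $G$. $G$ is topologically principal if $\{x\in G^{(0)}: xGx\neq\{x\}\}$ has empty interior in $G^{(0)}$. *)

(* Defs.v *)
(* "Provable in ZF" is rendered, via Goedel completeness, as "true in every
   model of ZF".  A model is an arbitrary type with a binary relation.  The
   axiom schemas range over first-order formulas only, so no choice principle
   of the ambient type theory is inherited by a model.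

   All mathematical objects (metric spaces, groupoids, families, functions,
   sequences, real numbers) are elements of the model.  A [V -> Prop] below
   plays the role of a class of set theory: it only abbreviates a formula with
   parameters, all quantifiers in it range over the model, and classes are
   never quantified over in the statements about models. *)

Set Implicit Arguments.
Unset Strict Implicit.

Record membership_structure := MembershipStructure {
  carrier :> Type;
  In : carrier -> carrier -> Prop
}.

Arguments In {_} _ _.
Notation "x ∈ y" := (In x y) (at level 70, no associativity).

(* First-order formulas of the language of set theory, with de Bruijn
   variables. *)
Inductive formula :=
| FIn (i j : nat)
| FEq (i j : nat)
| FFalse
| FImp (p q : formula)
| FAll (p : formula).

Definition scons {A : Type} (x : A) (rho : nat -> A) (n : nat) : A :=
  match n with 0 => x | S k => rho k end.

Fixpoint sat {V : membership_structure} (rho : nat -> V) (p : formula) : Prop :=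
  match p with
  | FIn i j => rho i ∈ rho j
  | FEq i j => rho i = rho j
  | FFalse => False
  | FImp p q => sat rho p -> sat rho q
  | FAll p => forall x : V, sat (scons x rho) p
  end.

Section SetTheory.
Context {V : membership_structure}.
Implicit Types (x y z a b f p w : V) (A D : V -> Prop).

Definition elts a : V -> Prop := fun x => x ∈ a.

Definition is_empty a : Prop := forall x, ~ x ∈ a.

Definition is_upair p x y : Prop := forall z, z ∈ p <-> z = x \/ z = y.

(* Kuratowski: p = {{x}, {x, y}} *)
Definition is_pair p x y : Prop :=
  exists a b, is_upair a x x /\ is_upair b x y /\ is_upair p a b.

Definition is_succ y x : Prop := forall z, z ∈ y <-> z ∈ x \/ z = x.

Definition inductive w : Prop :=
  (exists e, is_empty e /\ e ∈ w) /\
  (forall x, x ∈ w -> exists y, is_succ y x /\ y ∈ w).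

Definition is_omega w : Prop :=
  inductive w /\ forall w' : V, inductive w' -> forall x, x ∈ w -> x ∈ w'.

(* (x, y) ∈ f; for a function f this says f(x) = y *)
Definition pair_in f x y : Prop := exists p, is_pair p x y /\ p ∈ f.

(* f(x, y) = z *)
Definition pair_in2 f x y z : Prop := exists p, is_pair p x y /\ pair_in f p z.

Definition prod_class A D : V -> Prop :=
  fun p => exists x y, A x /\ D y /\ is_pair p x y.

Definition is_fun f A D : Prop :=
  (forall p, p ∈ f -> prod_class A D p) /\
  (forall x, A x -> exists! y, pair_in f x y).

Definition injective_on f A : Prop :=
  forall x x' y, A x -> A x' -> pair_in f x y -> pair_in f x' y -> x = x'.

Definition image f A : V -> Prop := fun y => exists x, A x /\ pair_in f x y.

Definition big_union a : V -> Prop := fun x => exists y, y ∈ a /\ x ∈ y.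

Definition countable a : Prop :=
  exists w f, is_omega w /\ is_fun f (elts a) (elts w) /\
              injective_on f (elts a).

End SetTheory.

Record ZF (V : membership_structure) : Prop := {
  zf_extensionality : forall a b : V, (forall x, x ∈ a <-> x ∈ b) -> a = b;
  zf_foundation : forall a : V, (exists x, x ∈ a) ->
    exists x, x ∈ a /\ ~ (exists y, y ∈ x /\ y ∈ a);
  zf_pairing : forall x y : V, exists p, is_upair p x y;
  zf_union : forall a : V, exists u, forall x, x ∈ u <-> big_union a x;
  zf_power : forall a : V, exists P, forall b,
    b ∈ P <-> (forall x, x ∈ b -> x ∈ a);
  zf_infinity : exists w : V, inductive w;
  zf_separation : forall (p : formula) (rho : nat -> V) (a : V),
    exists b, forall x, x ∈ b <-> x ∈ a /\ sat (scons x rho) p;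
  zf_replacement : forall (p : formula) (rho : nat -> V),
    (forall x y z, sat (scons x (scons y rho)) p ->
                   sat (scons x (scons z rho)) p -> y = z) ->
    forall a : V, exists b, forall y,
      y ∈ b <-> exists x, x ∈ a /\ sat (scons x (scons y rho)) p
}.

(* A topology is given by the class [T] of its open sets. *)
Section Topology.
Context {V : membership_structure}.
Implicit Types (U W S f : V) (X Y A D : V -> Prop) (T : V -> Prop).

Record is_topology X T : Prop := {
  open_sub : forall U, T U -> forall x, x ∈ U -> X x;
  open_whole : exists U, T U /\ forall x, x ∈ U <-> X x;
  open_inter : forall U W, T U -> T W ->
    exists I : V, T I /\ forall x, x ∈ I <-> x ∈ U /\ x ∈ W;
  open_union : forall S, (forall U, U ∈ S -> T U) ->
    exists U, T U /\ forall x, x ∈ U <-> big_union S x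
}.

Definition is_open T D : Prop := exists U, T U /\ forall x, x ∈ U <-> D x.

Definition is_closed X T D : Prop :=
  (forall x, D x -> X x) /\ is_open T (fun x => X x /\ ~ D x).

Definition interior T D : V -> Prop :=
  fun x => exists U, T U /\ x ∈ U /\ forall y, y ∈ U -> D y.

Definition closure X T D : V -> Prop :=
  fun x => X x /\ forall U, T U -> x ∈ U -> exists y, y ∈ U /\ D y.

Definition has_empty_interior T D : Prop := ~ exists x, interior T D x.

Definition subspace T Y : V -> Prop :=
  fun W => exists U, T U /\ forall x, x ∈ W <-> x ∈ U /\ Y x.

Definition product_topology X T Y T' : V -> Prop :=
  fun W => (forall p, p ∈ W -> prod_class X Y p) /\
    forall p, p ∈ W -> exists U U', T U /\ T' U' /\
      prod_class (elts U) (elts U') p /\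
      forall q, prod_class (elts U) (elts U') q -> q ∈ W.

(* continuity of f on the space (A, T), for the topology T' on the codomain *)
Definition continuous f A T T' : Prop :=
  forall U, T' U -> is_open T (fun x => A x /\ exists y, y ∈ U /\ pair_in f x y).

(* f restricted to A is a homeomorphism onto f(A), with respect to the
   subspace topologies of (A, T) and (f(A), T') *)
Definition homeo_onto_image f A T T' : Prop :=
  injective_on f A /\
  continuous f A (subspace T A) (subspace T' (image f A)) /\
  (forall U, subspace T A U ->
     is_open (subspace T' (image f A)) (image f (elts U))).

End Topology.

(* The real numbers are only determined up to isomorphism: any complete
   ordered field of the model may serve as the codomain of a metric. *)
Record field_data (V : membership_structure) := FieldData {
  fset : V; fadd : V; fmul : V; fle : V; fzero : V; fone : V
}.

Section Metric.
Context {V : membership_structure}.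
Implicit Types (R : field_data V) (x y z u v w S X d e : V).

Definition flt R x y : Prop := pair_in (fle R) x y /\ x <> y.

Definition upper_bound R S u : Prop :=
  u ∈ fset R /\ forall x, x ∈ S -> pair_in (fle R) x u.

Record complete_ordered_field R : Prop := {
  cof_zero : fzero R ∈ fset R;
  cof_one : fone R ∈ fset R;
  cof_add : is_fun (fadd R) (prod_class (elts (fset R)) (elts (fset R)))
                   (elts (fset R));
  cof_mul : is_fun (fmul R) (prod_class (elts (fset R)) (elts (fset R)))
                   (elts (fset R));
  cof_le : forall p : V, p ∈ fle R ->
    prod_class (elts (fset R)) (elts (fset R)) p;
  cof_addC : forall x y z, pair_in2 (fadd R) x y z -> pair_in2 (fadd R) y x z;
  cof_addA : forall x y z u v w,
    pair_in2 (fadd R) x y u -> pair_in2 (fadd R) u z w ->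
    pair_in2 (fadd R) y z v -> pair_in2 (fadd R) x v w;
  cof_add0 : forall x, x ∈ fset R -> pair_in2 (fadd R) x (fzero R) x;
  cof_opp : forall x, x ∈ fset R ->
    exists y, y ∈ fset R /\ pair_in2 (fadd R) x y (fzero R);
  cof_mulC : forall x y z, pair_in2 (fmul R) x y z -> pair_in2 (fmul R) y x z;
  cof_mulA : forall x y z u v w,
    pair_in2 (fmul R) x y u -> pair_in2 (fmul R) u z w ->
    pair_in2 (fmul R) y z v -> pair_in2 (fmul R) x v w;
  cof_mul1 : forall x, x ∈ fset R -> pair_in2 (fmul R) x (fone R) x;
  cof_inv : forall x, x ∈ fset R -> x <> fzero R ->
    exists y, y ∈ fset R /\ pair_in2 (fmul R) x y (fone R);
  cof_distr : forall x y z s t u v : V,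
    pair_in2 (fadd R) y z s -> pair_in2 (fmul R) x s t ->
    pair_in2 (fmul R) x y u -> pair_in2 (fmul R) x z v ->
    pair_in2 (fadd R) u v t;
  cof_one_neq_zero : fone R <> fzero R;
  cof_le_refl : forall x, x ∈ fset R -> pair_in (fle R) x x;
  cof_le_antisym : forall x y,
    pair_in (fle R) x y -> pair_in (fle R) y x -> x = y;
  cof_le_trans : forall x y z,
    pair_in (fle R) x y -> pair_in (fle R) y z -> pair_in (fle R) x z;
  cof_le_total : forall x y, x ∈ fset R -> y ∈ fset R ->
    pair_in (fle R) x y \/ pair_in (fle R) y x;
  cof_le_add : forall x y z u v, pair_in (fle R) x y ->
    pair_in2 (fadd R) x z u -> pair_in2 (fadd R) y z v -> pair_in (fle R) u v;
  cof_le_mul : forall x y z,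
    pair_in (fle R) (fzero R) x -> pair_in (fle R) (fzero R) y ->
    pair_in2 (fmul R) x y z -> pair_in (fle R) (fzero R) z;
  cof_lub : forall S, (forall x, x ∈ S -> x ∈ fset R) ->
    (exists x, x ∈ S) -> (exists u, upper_bound R S u) ->
    exists u, upper_bound R S u /\
      forall v, upper_bound R S v -> pair_in (fle R) u v
}.

Record is_metric R X d : Prop := {
  metric_fun : is_fun d (prod_class (elts X) (elts X)) (elts (fset R));
  metric_ge0 : forall x y u, pair_in2 d x y u -> pair_in (fle R) (fzero R) u;
  metric_eq0 : forall x y, x ∈ X -> y ∈ X ->
    (pair_in2 d x y (fzero R) <-> x = y);
  metric_sym : forall x y u, pair_in2 d x y u -> pair_in2 d y x u;
  metric_triangle : forall x y z u v w s : V,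
    pair_in2 d x y u -> pair_in2 d y z v -> pair_in2 d x z w ->
    pair_in2 (fadd R) u v s -> pair_in (fle R) w s
}.

(* d(x, y) < e *)
Definition dist_lt R d x y e : Prop :=
  exists u, pair_in2 d x y u /\ flt R u e.

Definition metric_topology R X d : V -> Prop :=
  fun U => (forall x, x ∈ U -> x ∈ X) /\
    forall x, x ∈ U -> exists e, flt R (fzero R) e /\
      forall y, y ∈ X -> dist_lt R d x y e -> y ∈ U.

Definition cauchy R d w u : Prop :=
  forall e, flt R (fzero R) e -> exists N : V, N ∈ w /\
    forall m n x y : V, m ∈ w -> n ∈ w ->
      (m = N \/ N ∈ m) -> (n = N \/ N ∈ n) ->
      pair_in u m x -> pair_in u n y -> dist_lt R d x y e.

Definition converges R d w u x : Prop :=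
  forall e, flt R (fzero R) e -> exists N : V, N ∈ w /\
    forall m y : V, m ∈ w -> (m = N \/ N ∈ m) ->
      pair_in u m y -> dist_lt R d y x e.

Record complete_metric_space R X d : Prop := {
  cms_field : complete_ordered_field R;
  cms_metric : is_metric R X d;
  cms_complete : forall w u, is_omega w -> is_fun u (elts w) (elts X) ->
    cauchy R d w u -> exists x, x ∈ X /\ converges R d w u x
}.

End Metric.

Record groupoid_data (V : membership_structure) := GroupoidData {
  arr : V; unit_space : V; rng : V; src : V; comp : V; inv : V
}.

Section Groupoid.
Context {V : membership_structure}.
Implicit Types (G : groupoid_data V) (g h k x y tau : V) (A B : V -> Prop).

(* the set of pairs (g, h) with s(g) = r(h) *)
Definition composable G : V -> Prop :=
  fun p => exists g h x, g ∈ arr G /\ h ∈ arr G /\ is_pair p g h /\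
    pair_in (src G) g x /\ pair_in (rng G) h x.

Record is_groupoid G : Prop := {
  unit_arr : forall x, x ∈ unit_space G -> x ∈ arr G;
  rng_fun : is_fun (rng G) (elts (arr G)) (elts (unit_space G));
  src_fun : is_fun (src G) (elts (arr G)) (elts (unit_space G));
  comp_fun : is_fun (comp G) (composable G) (elts (arr G));
  inv_fun : is_fun (inv G) (elts (arr G)) (elts (arr G));
  rng_unit : forall x, x ∈ unit_space G -> pair_in (rng G) x x;
  src_unit : forall x, x ∈ unit_space G -> pair_in (src G) x x;
  rng_comp : forall g h k x,
    pair_in2 (comp G) g h k -> pair_in (rng G) g x -> pair_in (rng G) k x;
  src_comp : forall g h k x,
    pair_in2 (comp G) g h k -> pair_in (src G) h x -> pair_in (src G) k x;
  comp_assoc : forall g h k gh hk l : V,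
    pair_in2 (comp G) g h gh -> pair_in2 (comp G) gh k l ->
    pair_in2 (comp G) h k hk -> pair_in2 (comp G) g hk l;
  comp_unit_l : forall g x, pair_in (rng G) g x -> pair_in2 (comp G) x g g;
  comp_unit_r : forall g x, pair_in (src G) g x -> pair_in2 (comp G) g x g;
  rng_inv : forall g h x,
    pair_in (inv G) g h -> pair_in (src G) g x -> pair_in (rng G) h x;
  src_inv : forall g h x,
    pair_in (inv G) g h -> pair_in (rng G) g x -> pair_in (src G) h x;
  comp_inv_r : forall g h x,
    pair_in (inv G) g h -> pair_in (rng G) g x -> pair_in2 (comp G) g h x;
  comp_inv_l : forall g h x,
    pair_in (inv G) g h -> pair_in (src G) g x -> pair_in2 (comp G) h g x
}.

Record topological_groupoid G tau : Prop := {
  tg_groupoid : is_groupoid G;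
  tg_topology : is_topology (elts (arr G)) (elts tau);
  tg_comp : continuous (comp G) (composable G)
    (subspace (product_topology (elts (arr G)) (elts tau)
                                (elts (arr G)) (elts tau)) (composable G))
    (elts tau);
  tg_inv : continuous (inv G) (elts (arr G)) (elts tau) (elts tau)
}.

Definition unit_topology G tau : V -> Prop :=
  subspace (elts tau) (elts (unit_space G)).

Definition unit_space_complete_metric G tau : Prop :=
  exists (R : field_data V) (d : V),
    complete_metric_space R (unit_space G) d /\
    forall U : V, unit_topology G tau U <-> metric_topology R (unit_space G) d U.

(* xGx *)
Definition isotropy G x : V -> Prop :=
  fun g => g ∈ arr G /\ pair_in (rng G) g x /\ pair_in (src G) g x.

Definition Iso G : V -> Prop :=
  fun g => exists x, x ∈ unit_space G /\ isotropy G x g.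

Definition open_bisection G tau A : Prop :=
  (forall g, A g -> g ∈ arr G) /\
  is_open (elts tau) A /\
  is_open (elts tau) (image (rng G) A) /\
  is_open (elts tau) (image (src G) A) /\
  homeo_onto_image (rng G) A (elts tau) (elts tau) /\
  homeo_onto_image (src G) A (elts tau) (elts tau).

Record neighbourhood_bisection G tau B : Prop := {
  nb_sub : forall g, B g -> g ∈ arr G;
  nb_closure : forall g, B g ->
    closure (elts (arr G)) (elts tau) (interior (elts tau) B) g;
  nb_rng_inj : injective_on (rng G) B;
  nb_src_inj : injective_on (src G) B;
  nb_rng_open : is_open (elts tau) (image (rng G) B);
  nb_src_open : is_open (elts tau) (image (src G) B);
  nb_interior : open_bisection G tau (interior (elts tau) B);
  nb_boundary : forall g, B g -> ~ interior (elts tau) B g ->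
    Iso G g /\ ~ g ∈ unit_space G
}.

Definition countable_nbhd_bisection_cover G tau : Prop :=
  exists C : V, countable C /\
    (forall B : V, B ∈ C -> neighbourhood_bisection G tau (elts B)) /\
    forall g, g ∈ arr G -> big_union C g.

Definition effective G tau : Prop :=
  has_empty_interior (elts tau) (fun g => Iso G g /\ ~ g ∈ unit_space G).

Definition topologically_principal G tau : Prop :=
  has_empty_interior (unit_topology G tau)
    (fun x => x ∈ unit_space G /\ ~ (forall g, isotropy G x g <-> g = x)).

End Groupoid.

Definition baire_category_theorem (V : membership_structure) : Prop :=
  forall (R : field_data V) (X d : V), complete_metric_space R X d ->
  forall C : V, countable C ->
  (forall c, c ∈ C ->
     is_closed (elts X) (metric_topology R X d) (elts c) /\
     has_empty_interior (metric_topology R X d) (elts c)) ->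
  has_empty_interior (metric_topology R X d) (big_union C).

Definition effective_implies_principal (V : membership_structure) : Prop :=
  forall (G : groupoid_data V) (tau : V), topological_groupoid G tau ->
  unit_space_complete_metric G tau ->
  countable_nbhd_bisection_cover G tau ->
  effective G tau -> topologically_principal G tau.

(* Main.v *)
From Stdlib Require Import Classical FunctionalExtensionality PropExtensionality.
Require Import Defs.

(** Let [X] be the unit space of [G].

    Baire implies principality.  For a neighbourhood bisection [B] of the
    cover let [N_B] be the set of units [x] with a non-trivial element of
    [xGx] in [B].  The units with non-trivial isotropy form the union of the
    countably many [N_B], so it suffices that the closure of [N_B] in [X] has
    empty interior ([support_nowhere_dense]).  If not, [B] has interior points
    over an open set [U] of units in which [N_B] is dense.  The partial
    homeomorphism of [X] induced by the interior of [B] fixes the points of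
    [N_B], hence all of [U] because [X] is Hausdorff, and the elements of [B]
    over [U] then form an open set of non-trivial isotropy, against
    effectiveness.

    Principality implies Baire.  Closed sets [C_n] with empty interior are
    first replaced by the disjoint pieces [C_n - (C_0 ∪ ... ∪ C_(n-1))],
    which are locally closed ([locally_closed_pieces]).  Over each point of a
    piece one non-trivial arrow is added to [X], making the isotropy group
    there cyclic of order two.  A piece [S] gives a section of this group
    bundle that is non-trivial on [S] and trivial near the points not adherent
    to [S].  Declaring the restrictions of these sections to open subsets of
    [X] to be open yields an etale groupoid: its composition is continuous because the square
    of a section consists of units, and because [S] is locally closed.  It is
    covered by these countably many open bisections, and it is effective
    because every neighbourhood of a non-trivial arrow over [S] contains the
    nearby units outside [S], which exist as [S] has empty interior.  The
    units with non-trivial isotropy are exactly the points of the [C_n]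
    ([doubling_exists]).

    Both directions avoid choice.  Countability is transported along definable
    images by least preimages ([countable_family]).  Separation is only
    available for first-order formulas, so that every set formed on the way
    needs a defining formula; these are produced by closure properties of
    [definable] under the logical connectives. *)

(** * Definable classes *)

Section Definability.
Context {V : membership_structure}.
Implicit Types (rho : nat -> V) (P Q : (nat -> V) -> Prop).

Fixpoint rename (f : nat -> nat) (p : formula) : formula :=
  match p with
  | FIn i j => FIn (f i) (f j)
  | FEq i j => FEq (f i) (f j)
  | FFalse => FFalse
  | FImp p q => FImp (rename f p) (rename f q)
  | FAll p =>
      FAll (rename (fun n => match n with 0 => 0 | S k => S (f k) end) p)
  end.

Lemma sat_rename p : forall f rho,
  sat rho (rename f p) <-> sat (fun n => rho (f n)) p.
Proof.
  induction p as [i j|i j| |p IHp q IHq|p IHp]; intros f rho; simpl; try tauto.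
  - rewrite IHp, IHq; tauto.
  - split; intros K x; specialize (K x);
      [apply IHp in K | apply IHp];
      (* both valuations give x to the bound variable *)
      match goal with
      | K : sat ?r p |- sat ?r' p => replace r' with r; [exact K|]
      end;
      apply functional_extensionality; intros [|k]; reflexivity.
Qed.

(** A term is a variable of the valuation or a set of the model used as a
    parameter. *)
Definition eval rho (a : nat + V) : V :=
  match a with inl i => rho i | inr v => v end.

(** Each free variable of the formula is assigned a variable or a parameter by
    [e]; keeping the two kinds apart lets the connectives merge the parameters
    of their arguments without any bookkeeping on arities. *)
Definition definable P : Prop :=
  exists (p : formula) (e : nat -> nat + V),
    forall rho, P rho <-> sat (fun n => eval rho (e n)) p.

Definition is_term (t : (nat -> V) -> V) : Prop :=
  exists a, forall rho, t rho = eval rho a.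

Lemma term_var k : is_term (fun rho => rho k).
Proof. exists (inl k); reflexivity. Qed.

Lemma term_const v : is_term (fun _ => v).
Proof. exists (inr v); reflexivity. Qed.

Lemma def_in t u : is_term t -> is_term u ->
  definable (fun rho => t rho ∈ u rho).
Proof.
  intros [a Ha] [b Hb].
  exists (FIn 0 1), (fun n => match n with 0 => a | _ => b end).
  intro rho; simpl; rewrite Ha, Hb; tauto.
Qed.

Lemma def_eq t u : is_term t -> is_term u ->
  definable (fun rho => t rho = u rho).
Proof.
  intros [a Ha] [b Hb].
  exists (FEq 0 1), (fun n => match n with 0 => a | _ => b end).
  intro rho; simpl; rewrite Ha, Hb; tauto.
Qed.

Lemma def_false : definable (fun _ => False).
Proof. exists FFalse, (fun n => inl n); simpl; tauto. Qed.

Fixpoint double (n : nat) : nat :=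
  match n with 0 => 0 | S k => S (S (double k)) end.

Fixpoint merge {A : Type} (e e' : nat -> A) (n : nat) : A :=
  match n with
  | 0 => e 0
  | 1 => e' 0
  | S (S k) => merge (fun i => e (S i)) (fun i => e' (S i)) k
  end.

Lemma merge_even {A : Type} n :
  forall e e' : nat -> A, merge e e' (double n) = e n.
Proof. induction n; intros; simpl; trivial; apply IHn. Qed.

Lemma merge_odd {A : Type} n :
  forall e e' : nat -> A, merge e e' (S (double n)) = e' n.
Proof.
  induction n as [|n IHn]; intros; [reflexivity|].
  exact (IHn (fun i => e (S i)) (fun i => e' (S i))).
Qed.

Lemma def_imp P Q : definable P -> definable Q ->
  definable (fun rho => P rho -> Q rho).
Proof.
  intros [p [e He]] [q [e' He']].
  exists (FImp (rename double p) (rename (fun n => S (double n)) q)),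
    (merge e e').
  intro rho; cbn [sat]; rewrite !sat_rename, He, He'.
  replace (fun n => eval rho (merge e e' (double n)))
    with (fun n => eval rho (e n))
    by (apply functional_extensionality; intro; now rewrite merge_even).
  replace (fun n => eval rho (merge e e' (S (double n))))
    with (fun n => eval rho (e' n))
    by (apply functional_extensionality; intro; now rewrite merge_odd).
  tauto.
Qed.

Lemma def_equiv P Q : (forall rho, P rho <-> Q rho) ->
  definable P -> definable Q.
Proof.
  intros H [p [e He]]; exists p, e; intro rho; rewrite <- H; apply He.
Qed.

Lemma def_not P : definable P -> definable (fun rho => ~ P rho).
Proof. intro HP; apply def_imp; [exact HP|apply def_false]. Qed.

Lemma def_and P Q : definable P -> definable Q ->
  definable (fun rho => P rho /\ Q rho).
Proof.
  intros HP HQ; apply def_equiv with (fun rho => ~ (P rho -> ~ Q rho)).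
  - intro; tauto.
  - apply def_not, def_imp, def_not; assumption.
Qed.

Lemma def_or P Q : definable P -> definable Q ->
  definable (fun rho => P rho \/ Q rho).
Proof.
  intros HP HQ; apply def_equiv with (fun rho => ~ P rho -> Q rho).
  - intro; tauto.
  - apply def_imp; [apply def_not|]; assumption.
Qed.

Lemma def_iff P Q : definable P -> definable Q ->
  definable (fun rho => P rho <-> Q rho).
Proof. intros; apply def_and; apply def_imp; assumption. Qed.

Lemma def_all (Q : (nat -> V) -> V -> Prop) :
  definable (fun rho => Q (fun n => rho (S n)) (rho 0)) ->
  definable (fun rho => forall x, Q rho x).
Proof.
  intros [p [e He]].
  (* Variable 0 becomes the bound variable; all others move past it. *)
  exists (FAll (rename (fun n => match e n with inl 0 => 0 | _ => S n end) p)),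
    (fun n => match e n with
              | inl 0 => inl 0 | inl (S i) => inl i | inr v => inr v end).
  intro rho; cbn [sat].
  assert (H : forall x, Q rho x <->
    sat (scons x (fun n => eval rho
           (match e n with
            | inl 0 => inl 0 | inl (S i) => inl i | inr v => inr v end)))
      (rename (fun n => match e n with inl 0 => 0 | _ => S n end) p)).
  { intro x; rewrite sat_rename; specialize (He (scons x rho)).
    cbn [scons] in He.
    rewrite He.
    replace (fun n => eval (scons x rho) (e n)) with
      (fun n => scons x (fun k => eval rho
           (match e k with
            | inl 0 => inl 0 | inl (S i) => inl i | inr v => inr v end))
        (match e n with inl 0 => 0 | _ => S n end)); [tauto|].
    apply functional_extensionality; intro n.
    destruct (e n) as [[|i]|v] eqn:E; cbn; rewrite ?E; reflexivity. }
  split; intros K x; apply H, K.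
Qed.

Lemma def_ex (Q : (nat -> V) -> V -> Prop) :
  definable (fun rho => Q (fun n => rho (S n)) (rho 0)) ->
  definable (fun rho => exists x, Q rho x).
Proof.
  intro HQ; apply def_equiv with (fun rho => ~ forall x, ~ Q rho x).
  - intro rho; split; [|firstorder].
    intro H; apply NNPP; firstorder.
  - apply def_not, def_all, def_not, HQ.
Qed.

Definition definable_class (A : V -> Prop) : Prop :=
  definable (fun rho => A (rho 0)).

Definition definable_rel (A : V -> V -> Prop) : Prop :=
  definable (fun rho => A (rho 0) (rho 1)).

Lemma def_rel (A : V -> V -> Prop) t u : definable_rel A ->
  is_term t -> is_term u -> definable (fun rho => A (t rho) (u rho)).
Proof.
  intros [p [e He]] [a Ha] [b Hb].
  pose (sub := fun i : nat => match i with 0 => a | _ => b end).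
  exists p, (fun n => match e n with inl i => sub i | inr v => inr v end).
  intro rho; specialize (He (fun i => eval rho (sub i))).
  cbn in He; rewrite Ha, Hb, He.
  replace (fun n => eval (fun i => eval rho (sub i)) (e n)) with
    (fun n => eval rho (match e n with inl i => sub i | inr v => inr v end));
    [tauto|].
  apply functional_extensionality; intro n; destruct (e n); reflexivity.
Qed.

Lemma def_class (A : V -> Prop) t : definable_class A -> is_term t ->
  definable (fun rho => A (t rho)).
Proof.
  intros HA Ht; exact (def_rel (fun x _ => A x) t t HA Ht Ht).
Qed.

End Definability.

Ltac term := first [apply term_const | apply term_var].

(** Follows the syntax of the class down to its atoms.  Unification unfolds
    abbreviations such as [is_pair] to reach their connectives. *)
Ltac definability :=
  unfold definable_class, definable_rel; cbn beta;
  repeat (cbn beta; first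
    [ apply def_in; term
    | apply def_eq; term
    | apply def_false
    | eapply def_rel; [eassumption | term | term]
    | eapply def_class; [eassumption | term]
    | apply def_and | apply def_or | apply def_iff | apply def_not
    | apply def_imp | apply def_ex | apply def_all ]).

(** * Basic constructions inside a model of ZF *)

Section Sets.
Context {V : membership_structure} (hV : ZF V).
Implicit Types (x y z a b c e f p w A C X : V).

Lemma set_ext a b : (forall x, x ∈ a <-> x ∈ b) -> a = b.
Proof. apply (zf_extensionality hV). Qed.

Lemma separation (A : V -> Prop) a : definable_class A ->
  exists b, forall x, x ∈ b <-> x ∈ a /\ A x.
Proof.
  intros [p [e He]].
  destruct (zf_separation hV
    (rename (fun n => match e n with inl _ => 0 | inr _ => S n end) p)
    (fun n => match e n with inl _ => a | inr v => v end) a) as [b Hb].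
  exists b; intro x; rewrite Hb, sat_rename, (He (fun _ => x)).
  replace (fun n => eval (fun _ => x) (e n)) with
   (fun n => scons x (fun k => match e k with inl _ => a | inr v => v end)
        (match e n with inl _ => 0 | inr _ => S n end)); [tauto|].
  apply functional_extensionality; intro n.
  destruct (e n) as [i|v] eqn:E; cbn; rewrite ?E; reflexivity.
Qed.


Lemma upair_ext a b x y : is_upair a x y -> is_upair b x y -> a = b.
Proof. intros Ha Hb; apply set_ext; intro z; rewrite (Ha z), (Hb z); tauto. Qed.

Lemma pair_exists x y : exists p, is_pair p x y.
Proof.
  destruct (zf_pairing hV x x) as [a Ha].
  destruct (zf_pairing hV x y) as [b Hb].
  destruct (zf_pairing hV a b) as [p Hp].
  exists p, a, b; auto.
Qed.

Lemma pair_ext p q x y : is_pair p x y -> is_pair q x y -> p = q.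
Proof.
  intros (a & b & Ha & Hb & Hp) (a' & b' & Ha' & Hb' & Hq).
  rewrite (upair_ext _ _ _ _ Ha' Ha), (upair_ext _ _ _ _ Hb' Hb) in Hq.
  exact (upair_ext _ _ _ _ Hp Hq).
Qed.

Lemma pair_inj p x y x' y' :
  is_pair p x y -> is_pair p x' y' -> x = x' /\ y = y'.
Proof.
  intros (a & b & Ha & Hb & Hp) (a' & b' & Ha' & Hb' & Hp').
  assert (H1 : a = a' \/ a = b') by (apply Hp', Hp; auto).
  assert (H2 : b = a' \/ b = b') by (apply Hp', Hp; auto).
  assert (H3 : b' = a \/ b' = b) by (apply Hp, Hp'; auto).
  assert (E : x = x').
  { destruct H1 as [<-|<-].
    - destruct (proj1 (Ha' x)); auto; apply Ha; auto.
    - destruct (proj1 (Ha x')); auto; apply Hb'; auto. }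
  subst x'; split; [reflexivity|].
  assert (Y : y = x \/ y = y').
  { destruct H2 as [-> | ->].
    - left; destruct (proj1 (Ha' y)); auto; apply Hb; auto.
    - apply Hb', Hb; auto. }
  assert (Y' : y' = x \/ y' = y).
  { destruct H3 as [-> | ->].
    - left; destruct (proj1 (Ha y')); auto; apply Hb'; auto.
    - apply Hb, Hb'; auto. }
  destruct Y as [-> | ]; [destruct Y'|]; auto.
Qed.

Lemma pair_in2_iff f p x y z : is_pair p x y ->
  (pair_in2 f x y z <-> pair_in f p z).
Proof.
  intro Hp; split.
  - intros (q & Hq & Hf); rewrite (pair_ext _ _ _ _ Hp Hq); exact Hf.
  - intro Hf; exists p; auto.
Qed.

Lemma product_exists a b :
  exists P, forall p, p ∈ P <-> prod_class (elts a) (elts b) p.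
Proof.
  destruct (zf_pairing hV a b) as [ab Hab].
  destruct (zf_union hV ab) as [u Hu].
  destruct (zf_power hV u) as [pu Hpu].
  destruct (zf_power hV pu) as [ppu Hppu].
  destruct (separation (prod_class (elts a) (elts b)) ppu) as [P HP];
    [definability|].
  exists P; intro p; rewrite HP; split; [tauto|].
  intro H; split; [|exact H].
  destruct H as (x & y & Hx & Hy & c & d & Hc & Hd & Hp).
  assert (Ux : x ∈ u) by (apply Hu; exists a; split; [apply Hab|]; auto).
  assert (Uy : y ∈ u) by (apply Hu; exists b; split; [apply Hab|]; auto).
  apply Hppu; intros z Hz; apply Hpu; intros t Ht.
  apply Hp in Hz; destruct Hz as [-> | ->];
    [apply Hc in Ht | apply Hd in Ht]; destruct Ht as [-> | ->]; assumption.
Qed.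

Lemma graph_exists (P : V -> V -> Prop) a b : definable_rel P ->
  exists f, (forall p, p ∈ f -> prod_class (elts a) (elts b) p) /\
    forall x y, pair_in f x y <-> x ∈ a /\ y ∈ b /\ P x y.
Proof.
  intro HP.
  destruct (product_exists a b) as [c Hc].
  destruct (separation (fun p => exists x y, is_pair p x y /\ P x y) c)
    as [f Hf]; [definability|].
  exists f; split.
  - intros p Hp; apply Hc, Hf, Hp.
  - intros x y; split.
    + intros (p & Hp & Hpf); apply Hf in Hpf.
      destruct Hpf as (Hpc & x' & y' & Hp' & Hxy).
      apply Hc in Hpc; destruct Hpc as (x2 & y2 & Hx & Hy & Hp2).
      destruct (pair_inj _ _ _ _ _ Hp Hp') as [<- <-].
      destruct (pair_inj _ _ _ _ _ Hp Hp2) as [<- <-]; auto.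
    + intros (Hx & Hy & Hxy); destruct (pair_exists x y) as [p Hp].
      exists p; split; [exact Hp|]; apply Hf; split; [|exists x, y; auto].
      apply Hc; exists x, y; auto.
Qed.

Lemma function_value f (A D : V -> Prop) x :
  is_fun f A D -> A x -> exists y, D y /\ pair_in f x y.
Proof.
  intros [Hs Hf] Hx; destruct (Hf x Hx) as (y & Hy & _).
  exists y; split; [|exact Hy].
  destruct Hy as (p & Hp & Hpf).
  destruct (Hs p Hpf) as (x' & y' & _ & HD & Hp').
  destruct (pair_inj _ _ _ _ _ Hp Hp') as [_ ->]; exact HD.
Qed.

Lemma function_typed f (A D : V -> Prop) x y :
  is_fun f A D -> pair_in f x y -> A x /\ D y.
Proof.
  intros [Hs _] (p & Hp & Hpf).
  destruct (Hs p Hpf) as (x' & y' & HA & HD & Hp').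
  destruct (pair_inj _ _ _ _ _ Hp Hp') as [-> ->]; auto.
Qed.

Lemma function_unique f (A D : V -> Prop) x y y' :
  is_fun f A D -> pair_in f x y -> pair_in f x y' -> y = y'.
Proof.
  intros Hf Hy Hy'; destruct (function_typed _ _ _ _ _ Hf Hy) as [HA _].
  destruct (proj2 Hf x HA) as (z & _ & Hz).
  rewrite <- (Hz y Hy); apply Hz, Hy'.
Qed.

Lemma binary_value f (A B D : V -> Prop) x y :
  is_fun f (prod_class A B) D -> A x -> B y ->
  exists z, D z /\ pair_in2 f x y z.
Proof.
  intros Hf Hx Hy; destruct (pair_exists x y) as [p Hp].
  destruct (function_value f _ D p Hf) as (z & Hz & Hpz);
    [exists x, y; auto|].
  exists z; split; [exact Hz|exists p; auto].
Qed.

Lemma binary_typed f (A B D : V -> Prop) x y z :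
  is_fun f (prod_class A B) D -> pair_in2 f x y z -> A x /\ B y /\ D z.
Proof.
  intros Hf (p & Hp & Hz).
  destruct (function_typed _ _ _ _ _ Hf Hz)
    as [(x' & y' & Hx & Hy & Hp') HD].
  destruct (pair_inj _ _ _ _ _ Hp Hp') as [-> ->]; auto.
Qed.

Lemma binary_unique f (A D : V -> Prop) x y z z' :
  is_fun f A D -> pair_in2 f x y z -> pair_in2 f x y z' -> z = z'.
Proof.
  intros Hf (p & Hp & Hz) H.
  apply (pair_in2_iff _ _ _ _ _ Hp) in H.
  exact (function_unique _ _ _ _ _ _ Hf Hz H).
Qed.

Lemma no_cycle3 x y z : x ∈ y -> y ∈ z -> ~ z ∈ x.
Proof.
  intros Hxy Hyz Hzx.
  destruct (zf_pairing hV x y) as [a Ha].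
  destruct (zf_pairing hV z z) as [b Hb].
  destruct (zf_pairing hV a b) as [c Hc].
  destruct (zf_union hV c) as [u Hu].
  assert (U : forall t, t ∈ u <-> t = x \/ t = y \/ t = z).
  { intro t; rewrite Hu; split.
    - intros (s & Hs & Ht); apply Hc in Hs; destruct Hs as [-> | ->];
        [apply Ha in Ht | apply Hb in Ht]; tauto.
    - intros [ | [ | ]].
      + exists a; rewrite (Hc a), (Ha t); tauto.
      + exists a; rewrite (Hc a), (Ha t); tauto.
      + exists b; rewrite (Hc b), (Hb t); tauto. }
  destruct (@zf_foundation _ hV u) as (m & Hm & Hmin);
    [exists x; apply U; auto|].
  apply Hmin; apply U in Hm; destruct Hm as [-> | [-> | ->]].
  - exists z; rewrite U; auto.
  - exists x; rewrite U; auto.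
  - exists y; rewrite U; auto.
Qed.

Lemma in_irrefl x : ~ x ∈ x.
Proof. intro H; exact (no_cycle3 _ _ _ H H H). Qed.

Lemma pair_not_in p x a : is_pair p x a -> ~ p ∈ a.
Proof.
  intros (b & c & _ & Hc & Hp) H.
  apply (no_cycle3 a c p); [apply Hc | apply Hp | exact H]; auto.
Qed.

(** * Natural numbers and countable families *)

Section Omega.
Variables (w : V) (hw : is_omega w).
Implicit Types (k m n : V).

Lemma omega_ind (P : V -> Prop) : definable_class P ->
  (forall n, n ∈ w -> is_empty n -> P n) ->
  (forall n m, n ∈ w -> m ∈ w -> is_succ m n -> P n -> P m) ->
  forall n, n ∈ w -> P n.
Proof.
  intros HP H0 HS.
  destruct (separation P w) as [v Hv]; [exact HP|].
  assert (I : inductive v).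
  { destruct hw as [[(e & He & Hew) Hs] _]; split.
    - exists e; split; [exact He|]; apply Hv; auto.
    - intros n Hn; apply Hv in Hn; destruct Hn as [Hn HPn].
      destruct (Hs n Hn) as (m & Hm & Hmw).
      exists m; split; [exact Hm|]; apply Hv; eauto. }
  intros n Hn; apply Hv; apply (proj2 hw); assumption.
Qed.

Lemma omega_trans n : n ∈ w -> forall m, m ∈ n -> forall k, k ∈ m -> k ∈ n.
Proof.
  revert n; refine (omega_ind _ _ _ _); [definability| |].
  - intros n _ He m Hm; destruct (He m Hm).
  - intros n n' _ _ Hs IH m Hm k Hk; apply Hs; left.
    apply Hs in Hm; destruct Hm as [Hm | ->]; eauto.
Qed.

Lemma omega_elt n : n ∈ w -> forall m, m ∈ n -> m ∈ w.
Proof.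
  revert n; refine (omega_ind _ _ _ _); [definability| |].
  - intros n _ He m Hm; destruct (He m Hm).
  - intros n n' Hn _ Hs IH m Hm.
    apply Hs in Hm; destruct Hm as [Hm | ->]; auto.
Qed.

Lemma omega_trichotomy n : n ∈ w ->
  forall m, m ∈ w -> m ∈ n \/ m = n \/ n ∈ m.
Proof.
  revert n; refine (omega_ind _ _ _ _); [definability| |].
  - intros n Hn He; refine (omega_ind _ _ _ _); [definability| |].
    + intros m _ He'; right; left.
      apply set_ext; intro z; split; intro Hz; exfalso;
        [exact (He' z Hz) | exact (He z Hz)].
    + intros m m' _ _ Hs [H | [-> | H]]; [destruct (He m H)| |];
        right; right; apply Hs; auto.
  - intros n n' Hn Hn' Hs IH.
    assert (L : forall m, m ∈ w -> n ∈ m -> m = n' \/ n' ∈ m).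
    { refine (omega_ind _ _ _ _); [definability| |].
      - intros m _ He H; destruct (He n H).
      - intros m m' _ _ Hs' IHm H; apply Hs' in H; destruct H as [H | ->].
        + right; apply Hs'; destruct (IHm H); auto.
        + left; apply set_ext; intro z; rewrite (Hs z), (Hs' z); tauto. }
    intros m Hm; destruct (IH m Hm) as [H | [-> | H]].
    + left; apply Hs; auto.
    + left; apply Hs; auto.
    + destruct (L m Hm H); auto.
Qed.

Lemma omega_asym n m : n ∈ w -> n ∈ m -> ~ m ∈ n.
Proof.
  intros Hn Hnm Hmn; exact (in_irrefl n (omega_trans n Hn m Hmn n Hnm)).
Qed.

Lemma omega_least (P : V -> Prop) : definable_class P ->
  (exists n, n ∈ w /\ P n) ->
  exists! n, n ∈ w /\ P n /\ forall m, m ∈ n -> ~ P m.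
Proof.
  intros HP (n0 & Hn0 & HPn0).
  destruct (separation P w) as [v Hv]; [exact HP|].
  destruct (@zf_foundation _ hV v) as (n & Hn & Hmin);
    [exists n0; apply Hv; auto|].
  apply Hv in Hn; destruct Hn as [Hn HPn].
  assert (M : forall m, m ∈ n -> ~ P m).
  { intros m Hm HPm; apply Hmin; exists m; split; [exact Hm|].
    apply Hv; split; [exact (omega_elt n Hn m Hm)|exact HPm]. }
  exists n; split; [auto|].
  intros m (Hm & HPm & Mm).
  destruct (omega_trichotomy n Hn m Hm) as [H | [H | H]].
  - destruct (M m H HPm).
  - auto.
  - destruct (Mm n H HPn).
Qed.

Lemma succ_inj n m k : n ∈ w -> is_succ k n -> is_succ k m -> n = m.
Proof.
  intros Hn Hkn Hkm.
  assert (H : n ∈ m \/ n = m) by (apply Hkm, Hkn; auto).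
  assert (H' : m ∈ n \/ m = n) by (apply Hkn, Hkm; auto).
  destruct H as [H|]; [destruct H' as [H'|]|]; auto.
  destruct (omega_asym n m Hn H H').
Qed.

(** Each element is sent to its least preimage, so that no choice is made. *)
Lemma countable_of_enumeration (F : V -> V -> Prop) C : definable_rel F ->
  (forall n y y', n ∈ w -> F n y -> F n y' -> y = y') ->
  (forall y, y ∈ C -> exists n, n ∈ w /\ F n y) -> countable C.
Proof.
  intros HF Hfun Hex.
  destruct (graph_exists
    (fun y n => F n y /\ forall m, m ∈ n -> ~ F m y) C w) as (f & Hf & Hpf);
    [definability|].
  exists w, f; split; [exact hw|]; split; [split; [exact Hf|]|].
  - intros y Hy.
    assert (D : definable_class (fun n => F n y)) by definability.
    destruct (omega_least _ D (Hex y Hy)) as (n & (Hn & Hl) & Hu).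
    exists n; split; [apply Hpf; auto|].
    intros n' Hn'; apply Hu; apply Hpf in Hn'; tauto.
  - intros y y' n Hy Hy' H H'; apply Hpf in H, H'.
    apply (Hfun n); tauto.
Qed.

End Omega.

(** Members of the family are classes cut out of a fixed set [X], so that the
    family is separated from the power set of [X].  A member may arise from
    many elements of [A]; it gets the least of their numbers. *)
Lemma countable_family (P : V -> V -> Prop) A X : definable_rel P ->
  countable A ->
  exists F, countable F /\
    (forall c, c ∈ F <->
       exists a, a ∈ A /\ forall x, x ∈ c <-> x ∈ X /\ P a x) /\
    (forall a, a ∈ A -> exists c, c ∈ F /\ forall x, x ∈ c <-> x ∈ X /\ P a x).
Proof.
  intros HP (w & f & Hw & Hf & Hinj).
  destruct (zf_power hV X) as [Y HY].
  destruct (separation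
    (fun c => exists a, a ∈ A /\ forall x, x ∈ c <-> x ∈ X /\ P a x) Y)
    as [F HF]; [definability|].
  assert (HF' : forall c, c ∈ F <->
       exists a, a ∈ A /\ forall x, x ∈ c <-> x ∈ X /\ P a x).
  { intro c; rewrite HF, HY; split; [tauto|].
    intros (a & Ha & Hc); split; [|eauto]; intros x Hx; apply Hc, Hx. }
  exists F; split; [|split; [exact HF'|]].
  - apply (countable_of_enumeration w Hw (fun n c : V => exists a, a ∈ A /\
      pair_in f a n /\ forall x, x ∈ c <-> x ∈ X /\ P a x));
      [definability| |].
    + intros n c c' _ (a & Ha & Hn & Hc) (a' & Ha' & Hn' & Hc').
      rewrite (Hinj a a' n Ha Ha' Hn Hn') in Hc.
      apply set_ext; intro x; rewrite (Hc x), (Hc' x); tauto.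
    + intros c Hc; apply HF' in Hc; destruct Hc as (a & Ha & Hc).
      destruct (function_value _ _ _ _ Hf Ha) as (n & Hn & Han).
      exists n; eauto 6.
  - intros a Ha; destruct (separation (P a) X) as [c Hc]; [definability|].
    exists c; split; [apply HF'; eauto|exact Hc].
Qed.

Lemma countable_insert e C : countable C ->
  exists C', countable C' /\ forall c, c ∈ C' <-> c ∈ C \/ c = e.
Proof.
  intros (w & f & Hw & Hf & Hinj).
  destruct (zf_pairing hV e e) as [s Hs].
  destruct (zf_pairing hV C s) as [Cs HCs].
  destruct (zf_union hV Cs) as [C' HC'].
  assert (H : forall c, c ∈ C' <-> c ∈ C \/ c = e).
  { intro c; rewrite HC'; split.
    - intros (y & Hy & Hc); apply HCs in Hy; destruct Hy as [-> | ->];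
        [tauto|apply Hs in Hc; tauto].
    - intros [Hc | ->]; [exists C|exists s];
        (split; [apply HCs; auto|]); [exact Hc|apply Hs; auto]. }
  exists C'; split; [|exact H].
  (* The new element takes the number 0 and the others move up by one. *)
  apply (countable_of_enumeration w Hw (fun n c : V =>
    (is_empty n /\ c = e) \/
    exists m, m ∈ w /\ is_succ n m /\ c ∈ C /\ pair_in f c m));
    [definability| |].
  - assert (Z : forall n m : V, is_empty n -> ~ is_succ n m)
      by (intros n m He Hnm; apply (He m), Hnm; auto).
    intros n c c' _ [[He ->] | (m & Hm & Hnm & Hc & Hcm)]
      [[He' ->] | (m' & Hm' & Hnm' & Hc' & Hcm')]; auto;
      try (exfalso; eapply Z; eassumption).
    rewrite <- (succ_inj w Hw m m' n Hm Hnm Hnm') in Hcm'.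
    exact (Hinj c c' m Hc Hc' Hcm Hcm').
  - intros c Hc; apply H in Hc; destruct Hc as [Hc | ->].
    + destruct (function_value _ _ _ _ Hf Hc) as (m & Hm & Hcm).
      destruct (proj2 (proj1 Hw) m Hm) as (n & Hnm & Hn).
      exists n; split; [exact Hn|]; right; exists m; auto.
    + destruct (proj1 (proj1 Hw)) as (z & Hz & Hzw).
      exists z; auto.
Qed.

End Sets.

(** * Topologies and metrics *)

Section Spaces.
Context {V : membership_structure} (hV : ZF V).
Implicit Types (R : field_data V) (X t D U W x y z u v w d e : V).

Lemma open_of_local X t D : is_topology (elts X) (elts t) ->
  (forall x, x ∈ D -> exists U, U ∈ t /\ x ∈ U /\ forall y, y ∈ U -> y ∈ D) ->
  D ∈ t.
Proof.
  intros Ht H.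
  destruct (separation hV (fun U => forall y, y ∈ U -> y ∈ D) t) as [S HS];
    [definability|].
  destruct (@open_union _ _ _ Ht S) as (U & HU & HUS).
  { intros U HU; apply HS, HU. }
  replace D with U; [exact HU|].
  apply (set_ext hV); intro x; rewrite HUS; split.
  - intros (W & HW & Hx); apply HS in HW; apply HW, Hx.
  - intro Hx; destruct (H x Hx) as (W & HW & HxW & HWD).
    exists W; split; [apply HS; auto|exact HxW].
Qed.

Lemma interior_open (T : V -> Prop) U :
  T U -> interior T (elts U) = elts U.
Proof.
  intro HU; apply functional_extensionality; intro x.
  apply propositional_extensionality; split.
  - intros (W & _ & Hx & HW); apply HW, Hx.
  - intro Hx; exists U; auto.
Qed.

Section Field.
Variables (R : field_data V) (hR : complete_ordered_field R).

Notation "a ≤ b" := (pair_in (fle R) a b) (at level 70).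
Notation "a < b" := (flt R a b).
Notation "a ⊕ b ≡ c" := (pair_in2 (fadd R) a b c) (at level 70, b at level 60).
Notation "0" := (fzero R).
Notation F := (fset R).

Lemma le_typed a b : a ≤ b -> a ∈ F /\ b ∈ F.
Proof.
  intros (p & Hp & H); destruct (cof_le hR H) as (x & y & Hx & Hy & Hp').
  destruct (pair_inj _ _ _ _ _ Hp Hp') as [-> ->]; auto.
Qed.

Lemma lt_typed a b : a < b -> a ∈ F /\ b ∈ F.
Proof. intros [H _]; exact (le_typed a b H). Qed.

Lemma lt_le_trans a b c : a < b -> b ≤ c -> a < c.
Proof.
  intros [H Hn] Hc; split; [exact (cof_le_trans hR H Hc)|].
  intros ->; apply Hn, (cof_le_antisym hR); assumption.
Qed.

Lemma le_lt_trans a b c : a ≤ b -> b < c -> a < c.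
Proof.
  intros H [Hc Hn]; split; [exact (cof_le_trans hR H Hc)|].
  intros ->; apply Hn, (cof_le_antisym hR); assumption.
Qed.

Lemma lt_irrefl a : ~ a < a.
Proof. intros [_ H]; auto. Qed.

Lemma add_unique a b c c' : a ⊕ b ≡ c -> a ⊕ b ≡ c' -> c = c'.
Proof. apply (binary_unique hV _ _ _ _ _ _ _ (cof_add hR)). Qed.

Lemma add_cancel a b c s : c ∈ F -> a ⊕ c ≡ s -> b ⊕ c ≡ s -> a = b.
Proof.
  intros Hc Ha Hb; destruct (cof_opp hR Hc) as (c' & Hc' & Ho).
  assert (L : forall x, x ∈ F -> x ⊕ c ≡ s -> s ⊕ c' ≡ x).
  { intros x Hx H.
    destruct (binary_typed _ _ _ _ _ _ _ (cof_add hR) H) as (_ & _ & Hs).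
    destruct (binary_value hV _ _ _ _ s c' (cof_add hR) Hs Hc') as (v & Hv & Hsv).
    pose proof (cof_addA hR H Hsv Ho) as K.
    rewrite (add_unique _ _ _ _ (cof_add0 hR Hx) K); exact Hsv. }
  destruct (binary_typed _ _ _ _ _ _ _ (cof_add hR) Ha) as (Fa & _ & _).
  destruct (binary_typed _ _ _ _ _ _ _ (cof_add hR) Hb) as (Fb & _ & _).
  apply (add_unique s c'); auto.
Qed.

Lemma lt_add a b c s r : c ∈ F -> a < b -> a ⊕ c ≡ s -> b ⊕ c ≡ r -> s < r.
Proof.
  intros Hc [H Hn] Hs Hr; split; [exact (cof_le_add hR H Hs Hr)|].
  intros ->; apply Hn; exact (add_cancel a b c r Hc Hs Hr).
Qed.

Lemma lt_diff a b : a < b -> exists c, 0 < c /\ a ⊕ c ≡ b.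
Proof.
  intro H; destruct (lt_typed _ _ H) as [Ha Hb].
  destruct (cof_opp hR Ha) as (a' & Ha' & Ho).
  destruct (binary_value hV _ _ _ _ b a' (cof_add hR) Hb Ha') as (c & Hc & Hbc).
  exists c; split; [exact (lt_add _ _ _ _ _ Ha' H Ho Hbc)|].
  (* a + (a' + b) = (a + a') + b = b *)
  exact (cof_addA hR Ho (cof_addC hR (cof_add0 hR Hb)) (cof_addC hR Hbc)).
Qed.

Lemma lt_add2 a b a' b' s s' :
  a < a' -> b < b' -> a ⊕ b ≡ s -> a' ⊕ b' ≡ s' -> s < s'.
Proof.
  intros Ha Hb Hs Hs'.
  destruct (lt_typed _ _ Ha) as [Fa Fa'], (lt_typed _ _ Hb) as [Fb Fb'].
  destruct (binary_value hV _ _ _ _ a' b (cof_add hR) Fa' Fb) as (r & Hr & Hab).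
  apply (lt_le_trans _ r); [exact (lt_add _ _ _ _ _ Fb Ha Hs Hab)|].
  exact (proj1 (lt_add _ _ _ _ _ Fa' Hb (cof_addC hR Hab) (cof_addC hR Hs'))).
Qed.

Lemma positive_exists : exists e, 0 < e.
Proof.
  destruct (cof_le_total hR (cof_zero hR) (cof_one hR)) as [H | H].
  - exists (fone R); split; [exact H|].
    intro E; exact (cof_one_neq_zero hR (eq_sym E)).
  - assert (L : fone R < 0) by (split; [exact H|exact (cof_one_neq_zero hR)]).
    destruct (lt_diff _ _ L) as (e & He & _); exists e; exact He.
Qed.

Lemma min_exists a b : 0 < a -> 0 < b -> exists c, 0 < c /\ c ≤ a /\ c ≤ b.
Proof.
  intros Ha Hb; destruct (lt_typed _ _ Ha) as [_ Fa], (lt_typed _ _ Hb) as [_ Fb].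
  pose proof (cof_le_refl hR Fa); pose proof (cof_le_refl hR Fb).
  destruct (cof_le_total hR Fa Fb); [exists a|exists b]; auto.
Qed.

Section Balls.
Variables (X d : V) (hd : is_metric R X d).

Lemma dist_value x y : x ∈ X -> y ∈ X -> exists u, u ∈ F /\ pair_in2 d x y u.
Proof. intros; apply (binary_value hV _ _ _ _ _ _ (metric_fun hd)); assumption. Qed.

Lemma metric_is_topology : is_topology (elts X) (metric_topology R X d).
Proof.
  split.
  - intros U [H _]; exact H.
  - exists X; split; [split; [auto|]|unfold elts; tauto].
    intros x Hx; destruct positive_exists as [e He]; exists e; auto.
  - intros U W [HUs HU] [HWs HW].
    destruct (separation hV (fun x => x ∈ W) U) as [I HI]; [definability|].
    exists I; split; [|exact HI]; split.
    + intros x Hx; apply HUs, HI, Hx.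
    + intros x Hx; apply HI in Hx; destruct Hx as [Hx Hx'].
      destruct (HU x Hx) as (e & He & Hball), (HW x Hx') as (e' & He' & Hball').
      destruct (min_exists e e' He He') as (c & Hc & Hce & Hce').
      exists c; split; [exact Hc|]; intros y Hy (u & Hu & Huc).
      apply HI; split; [apply Hball | apply Hball']; auto;
        exists u; split; auto; eapply lt_le_trans; eassumption.
  - intros S HS; destruct (zf_union hV S) as [U HU].
    exists U; split; [|exact HU]; split.
    + intros x Hx; apply HU in Hx; destruct Hx as (W & HW & Hx).
      exact (proj1 (HS W HW) x Hx).
    + intros x Hx; apply HU in Hx; destruct Hx as (W & HW & Hx).
      destruct (proj2 (HS W HW) x Hx) as (e & He & Hball).
      exists e; split; [exact He|]; intros y Hy Hlt.
      apply HU; exists W; auto.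
Qed.

Lemma ball_open x e : x ∈ X -> 0 < e ->
  exists U, metric_topology R X d U /\ x ∈ U /\
    forall y, y ∈ U <-> y ∈ X /\ dist_lt R d x y e.
Proof.
  intros Hx He.
  destruct (separation hV (fun y => dist_lt R d x y e) X) as [U HU];
    [definability|].
  exists U; split; [|split; [|exact HU]].
  - split; [intros y Hy; apply HU, Hy|].
    intros y Hy; apply HU in Hy; destruct Hy as (Hy & a & Ha & Hae).
    destruct (lt_diff a e Hae) as (c & Hc & Hac).
    exists c; split; [exact Hc|]; intros z Hz (u & Hu & Huc).
    apply HU; split; [exact Hz|].
    destruct (dist_value x z Hx Hz) as (v & Hv & Hxz).
    exists v; split; [exact Hxz|].
    destruct (lt_typed _ _ Hae) as [Fa _], (lt_typed _ _ Huc) as [Fu _].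
    destruct (binary_value hV _ _ _ _ u a (cof_add hR) Fu Fa) as (s & Hs & Hua).
    apply (le_lt_trans _ s).
    + exact (metric_triangle hd Ha Hu Hxz (cof_addC hR Hua)).
    + exact (lt_add u c a s e Fa Huc Hua (cof_addC hR Hac)).
  - apply HU; split; [exact Hx|]; exists 0; split; [|exact He].
    apply (metric_eq0 hd); auto.
Qed.

(** Radii [r] and [e - r] do, where [e] is the distance; if there is no [r]
    strictly between 0 and [e] then the balls of radius [e] are singletons.
    The distinction makes halving unnecessary. *)
Lemma metric_separated x y : x ∈ X -> y ∈ X -> x <> y ->
  exists U W, metric_topology R X d U /\ metric_topology R X d W /\
    x ∈ U /\ y ∈ W /\ forall z, z ∈ U -> ~ z ∈ W.
Proof.
  intros Hx Hy Hn.
  destruct (dist_value x y Hx Hy) as (e & Fe & He).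
  assert (Pe : 0 < e).
  { split; [exact (metric_ge0 hd He)|]; intros <-.
    apply Hn, (metric_eq0 hd); assumption. }
  destruct (classic (exists r, 0 < r /\ r < e)) as [(r & Hr & Hre) | Hno].
  - destruct (lt_diff r e Hre) as (c & Hc & Hrc).
    destruct (ball_open x r Hx Hr) as (U & HU & HxU & BU).
    destruct (ball_open y c Hy Hc) as (W & HW & HyW & BW).
    exists U, W; repeat (split; [assumption|]); intros z HzU HzW.
    apply BU in HzU; apply BW in HzW.
    destruct HzU as (Hz & u & Hu & Hur), HzW as (_ & v & Hv & Hvc).
    destruct (lt_typed _ _ Hur) as [Fu _], (lt_typed _ _ Hvc) as [Fv _].
    destruct (binary_value hV _ _ _ _ u v (cof_add hR) Fu Fv) as (s & Hs & Huv).
    apply (lt_irrefl e), (le_lt_trans _ s).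
    + exact (metric_triangle hd Hu (metric_sym hd Hv) He Huv).
    + exact (lt_add2 u v r c s e Hur Hvc Huv Hrc).
  - destruct (ball_open x e Hx Pe) as (U & HU & HxU & BU).
    destruct (ball_open y e Hy Pe) as (W & HW & HyW & BW).
    assert (Z : forall a z, a ∈ X -> z ∈ X -> dist_lt R d a z e -> a = z).
    { intros a z Ha Hz (u & Hu & Hue); apply (metric_eq0 hd); [auto..|].
      destruct (classic (0 = u)) as [-> | Hu0]; [exact Hu|].
      exfalso; apply Hno; exists u; split; [split|]; auto.
      exact (metric_ge0 hd Hu). }
    exists U, W; repeat (split; [assumption|]); intros z HzU HzW.
    apply BU in HzU; apply BW in HzW; destruct HzU as [Hz HzU], HzW as [_ HzW].
    apply Hn; rewrite (Z x z), (Z y z); auto.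
Qed.

End Balls.
End Field.
End Spaces.

(** * The Baire category theorem implies topological principality *)

Section Principality.
Context {V : membership_structure} (hV : ZF V).
Variables (G : groupoid_data V) (tau : V) (hG : topological_groupoid G tau).
Implicit Types (g h k x y z B C O U W : V).

Let hg : is_groupoid G := tg_groupoid hG.

Notation X := (unit_space G).

Lemma rng_continuous_at g x U : U ∈ tau -> pair_in (rng G) g x -> x ∈ U ->
  exists O, O ∈ tau /\ g ∈ O /\
    forall h y, h ∈ O -> pair_in (rng G) h y -> y ∈ U.
Proof.
  intros HU Hgx HxU.
  destruct (function_typed _ _ _ _ _ (rng_fun hg) Hgx) as [Hg _].
  destruct (function_value _ _ _ _ (inv_fun hg) Hg) as (g' & Hg' & Hinv).
  destruct (comp_inv_r hg Hinv Hgx) as (p & Hp & Hpx).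
  destruct (tg_comp hG HU) as (P' & (P & [_ HP] & HP') & HPU).
  assert (HpP : p ∈ P).
  { apply HP', HPU; split; [|exists x; auto].
    exact (proj1 (function_typed _ _ _ _ _ (comp_fun hg) Hpx)). }
  destruct (HP p HpP) as (U1 & U2 & HU1 & HU2 & (a & b & Ha & Hb & Hab) & Hsub).
  destruct (pair_inj _ _ _ _ _ Hp Hab) as [<- <-].
  destruct (tg_inv hG HU2) as (I & HI & HIe).
  destruct (open_inter (tg_topology hG) HU1 HI) as (O & HO & HOe).
  exists O; split; [exact HO|]; split.
  - apply HOe; split; [exact Ha|]; apply HIe; split; [exact Hg|].
    exists g'; auto.
  - intros h y Hh Hhy; apply HOe in Hh; destruct Hh as [Hh1 Hh2].
    apply HIe in Hh2; destruct Hh2 as (_ & h' & Hh' & Hhinv).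
    destruct (comp_inv_r hg Hhinv Hhy) as (q & Hq & Hqy).
    assert (Q : q ∈ P') by (apply HP'; split;
      [apply Hsub; exists h, h'; auto |
       exact (proj1 (function_typed _ _ _ _ _ (comp_fun hg) Hqy))]).
    apply HPU in Q; destruct Q as (_ & y' & Hy' & Hqy').
    rewrite (function_unique _ _ _ _ _ _ (comp_fun hg) Hqy Hqy'); exact Hy'.
Qed.

Lemma src_continuous_at g x U : U ∈ tau -> pair_in (src G) g x -> x ∈ U ->
  exists O, O ∈ tau /\ g ∈ O /\
    forall h y, h ∈ O -> pair_in (src G) h y -> y ∈ U.
Proof.
  intros HU Hgx HxU.
  destruct (function_typed _ _ _ _ _ (src_fun hg) Hgx) as [Hg _].
  destruct (function_value _ _ _ _ (inv_fun hg) Hg) as (g' & _ & Hinv).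
  destruct (rng_continuous_at g' x U HU (rng_inv hg Hinv Hgx) HxU)
    as (O & HO & HgO & Hsub).
  destruct (tg_inv hG HO) as (I & HI & HIe).
  exists I; split; [exact HI|]; split.
  - apply HIe; split; [exact Hg|]; exists g'; auto.
  - intros h y Hh Hhy; apply HIe in Hh; destruct Hh as (_ & h' & Hh' & Hhinv).
    exact (Hsub h' y Hh' (rng_inv hg Hhinv Hhy)).
Qed.

Variables (C : V)
  (hCB : forall B, B ∈ C -> neighbourhood_bisection G tau (elts B))
  (hCcov : forall g, g ∈ arr G -> big_union C g).

Lemma unit_space_open : X ∈ tau.
Proof.
  apply (open_of_local hV _ _ _ (tg_topology hG)); intros x Hx.
  destruct (hCcov x (unit_arr hg Hx)) as (B & HB & HxB).
  destruct (nb_rng_open (hCB B HB)) as (U & HU & HUe).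
  exists U; split; [exact HU|]; split.
  - apply HUe; exists x; split; [exact HxB|exact (rng_unit hg Hx)].
  - intros y Hy; apply HUe in Hy; destruct Hy as (g & _ & Hgy).
    exact (proj2 (function_typed _ _ _ _ _ (rng_fun hg) Hgy)).
Qed.

Lemma unit_open_iff U :
  unit_topology G tau U <-> U ∈ tau /\ forall x, x ∈ U -> x ∈ X.
Proof.
  split.
  - intros (W & HW & HWe).
    destruct (open_inter (tg_topology hG) HW unit_space_open)
      as (I & HI & HIe).
    split; [|intros x Hx; apply HWe, Hx].
    replace U with I; [exact HI|].
    apply (set_ext hV); intro x; rewrite (HWe x), (HIe x); unfold elts; tauto.
  - intros [HU HUX]; exists U; split; [exact HU|].
    intro x; unfold elts; split; [auto|tauto].
Qed.

Definition isotropy_support B x : Prop :=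
  exists g, g ∈ B /\ isotropy G x g /\ g <> x.

Hypothesis separated : forall x y, x ∈ X -> y ∈ X -> x <> y ->
  exists U W, unit_topology G tau U /\ unit_topology G tau W /\
    x ∈ U /\ y ∈ W /\ forall z, z ∈ U -> ~ z ∈ W.

Hypothesis eff : effective G tau.

(** If the support is dense in an open set [U] of units, then near an interior
    point of [B] with range in [U] every element [h] of [B] has equal range
    and source: units [y] of the support that approach [r(h)] are fixed by
    the partial homeomorphism induced by [B], and fixed points form a closed
    set because the unit space is Hausdorff.  Such an [h] is not a unit
    either: otherwise all units near [h] would lie in [B] and, as the range map
    is injective on [B], the support would miss them.  So there would be an
    open set of non-trivial isotropy. *)
Lemma support_nowhere_dense B : B ∈ C ->
  has_empty_interior (unit_topology G tau)
    (closure (elts X) (unit_topology G tau) (isotropy_support B)).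
Proof.
  intros HB (u & U & HU & HuU & HUcl).
  pose proof (hCB B HB) as nB.
  pose proof (tg_topology hG) as top.
  destruct (proj1 (unit_open_iff U) HU) as [HUt HUX].
  assert (S1 : exists O h, O ∈ tau /\ h ∈ O /\
      interior (elts tau) (elts B) h /\
      forall k y, k ∈ O -> pair_in (rng G) k y -> y ∈ U).
  { destruct (proj2 (HUcl u HuU) U HU HuU) as (y & HyU & g & HgB & [_ Hg] & _).
    destruct (rng_continuous_at g y U HUt (proj1 Hg) HyU)
      as (O & HO & HgO & Hsub).
    destruct (proj2 (nb_closure nB HgB) O HO HgO) as (h & HhO & Hh).
    exists O, h; auto. }
  destruct S1 as (O & h0 & HO & Hh0O & Hh0 & HOU).
  destruct (nb_interior nB) as (HAarr & (A & HA & HAe) & (rA & HrA & HrAe) & _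
    & (_ & _ & Hopen) & _).
  assert (HAB : forall k, k ∈ A -> k ∈ B).
  { intros k Hk; apply HAe in Hk; destruct Hk as (W & _ & Hk & HW).
    exact (HW k Hk). }
  assert (HAr : forall k, k ∈ A -> exists y, pair_in (rng G) k y).
  { intros k Hk; destruct (function_value _ _ _ k (rng_fun hg))
      as (y & _ & Hy); [apply HAarr, HAe, Hk|]; exists y; exact Hy. }
  (* The support meets the open set r(W).  As r is injective on B, the isotropy
     element found over the common point belongs to W. *)
  assert (S2 : forall W N k x, W ∈ tau -> (forall l, l ∈ W -> l ∈ A) ->
      k ∈ W -> pair_in (rng G) k x -> x ∈ U -> unit_topology G tau N -> x ∈ N ->
      exists l y, l ∈ W /\ y ∈ N /\ pair_in (rng G) l y /\
        pair_in (src G) l y /\ l <> y).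
  { intros W N k x HW HWA HkW Hkx HxU HN HxN.
    destruct (Hopen W) as (rW & (rW' & HrW' & HrWe') & HrWe).
    { exists W; split; [exact HW|].
      intro l; rewrite <- HAe; split; [auto|tauto]. }
    destruct (open_inter top HrW' HrA) as (I & HI & HIe).
    assert (HIr : forall y, y ∈ I <-> image (rng G) (elts W) y).
    { intro y; rewrite HIe, HrAe, <- HrWe, HrWe'; tauto. }
    destruct (proj1 (unit_open_iff N) HN) as [HNt HNX].
    destruct (open_inter top HI HNt) as (J & HJ & HJe).
    destruct (proj2 (HUcl x HxU) J) as (y & HyJ & g & HgB & (Hg & Hgr & Hgs) & Hgy).
    - apply unit_open_iff; split; [exact HJ|].
      intros y Hy; apply HNX, HJe, Hy.
    - apply HJe; split; [|exact HxN]; apply HIr; exists k; auto.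
    - apply HJe in HyJ; destruct HyJ as [HyI HyN].
      apply HIr in HyI; destruct HyI as (l & HlW & Hly).
      rewrite (nb_rng_inj nB HgB (HAB l (HWA l HlW)) Hgr Hly) in *.
      exists l, y; auto. }
  apply eff.
  destruct (open_inter top HA HO) as (N & HN & HNe).
  exists h0, N; split; [exact HN|]; split;
    [apply HNe; split; [apply HAe, Hh0|exact Hh0O]|].
  intros h Hh; apply HNe in Hh; destruct Hh as [HhA HhO].
  destruct (HAr h HhA) as (x & Hhx).
  pose proof (HOU h x HhO Hhx) as HxU.
  destruct (function_typed _ _ _ _ _ (rng_fun hg) Hhx) as [Hh HxX].
  split.
  - destruct (function_value _ _ _ _ (src_fun hg) Hh) as (z & HzX & Hhz).
    exists x; split; [exact HxX|]; split; [exact Hh|]; split; [exact Hhx|].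
    destruct (classic (x = z)) as [-> | Hne]; [exact Hhz|exfalso].
    destruct (separated x z HxX HzX Hne)
      as (Ux & Uz & HUx & HUz & HxUx & HzUz & Hdis).
    destruct (proj1 (unit_open_iff Uz) HUz) as [HUzt _].
    destruct (src_continuous_at h z Uz HUzt Hhz HzUz) as (O' & HO' & HhO' & Hs).
    destruct (open_inter top HA HO') as (W & HW & HWe).
    destruct (S2 W Ux h x HW) as (l & y & HlW & HyUx & _ & Hly & _); auto.
    + intros l Hl; apply HWe, Hl.
    + apply HWe; auto.
    + apply (Hdis y HyUx), (Hs l y); [apply HWe, HlW|exact Hly].
  - intro HhX.
    destruct (open_inter top HA unit_space_open) as (W & HW & HWe).
    destruct (S2 W U h x HW) as (l & y & HlW & _ & Hly & _ & Hne); auto.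
    + intros l Hl; apply HWe, Hl.
    + apply HWe; auto.
    + apply HWe in HlW; destruct HlW as [_ HlX]; apply Hne.
      exact (function_unique _ _ _ _ _ _ (rng_fun hg) (rng_unit hg HlX) Hly).
Qed.

End Principality.

Lemma baire_implies_principal (V : membership_structure) : ZF V ->
  baire_category_theorem V -> effective_implies_principal V.
Proof.
  intros hV baire G tau hG (R & d & hM & hRd) (C & hC & hCB & hCcov) eff.
  pose proof (tg_groupoid hG) as hg.
  assert (sep : forall x y, x ∈ unit_space G -> y ∈ unit_space G -> x <> y ->
    exists U W, unit_topology G tau U /\ unit_topology G tau W /\
      x ∈ U /\ y ∈ W /\ forall z, z ∈ U -> ~ z ∈ W).
  { intros x y Hx Hy Hn.
    destruct (metric_separated hV R (cms_field hM) _ d (cms_metric hM) x y Hx Hy Hn)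
      as (U & W & HU & HW & HUW).
    exists U, W; rewrite (hRd U), (hRd W); auto. }
  intros (x0 & U0 & HU0 & Hx0 & HU0sub).
  set (X := unit_space G) in *.
  set (P := fun B x => closure (elts X) (unit_topology G tau)
                         (isotropy_support G B) x).
  assert (DP : definable_rel P) by (unfold P, isotropy_support; definability).
  destruct (countable_family hV P C X DP hC) as (F & HF & HFe & HFex).
  assert (E : forall B c, (forall x, x ∈ c <-> x ∈ X /\ P B x) ->
            elts c = P B).
  { intros B c Hc; apply functional_extensionality; intro x.
    apply propositional_extensionality; unfold elts; rewrite Hc.
    split; [tauto|intro H; split; [exact (proj1 H)|exact H]]. }
  assert (top : metric_topology R X d = unit_topology G tau).
  { apply functional_extensionality; intro U.
    apply propositional_extensionality; symmetry; apply hRd. }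
  refine (baire R X d hM F HF _ _).
  - intros c Hc; apply HFe in Hc; destruct Hc as (B & HB & Hc).
    rewrite top, (E B c Hc); split.
    + split; [intros x Hx; exact (proj1 Hx)|].
      destruct (separation hV (fun x => ~ x ∈ c) X) as [D HD]; [definability|].
      exists D; split.
      * rewrite <- top; split; [intros x Hx; apply HD, Hx|].
        intros x Hx; apply HD in Hx; destruct Hx as [Hx Hxc].
        assert (Hn : exists U, unit_topology G tau U /\ x ∈ U /\
                  forall y, y ∈ U -> ~ isotropy_support G B y).
        { apply NNPP; intro Hno; apply Hxc, Hc; split; [exact Hx|].
          split; [exact Hx|]; intros U HU HxU; apply NNPP; intro Hno'.
          apply Hno; exists U; split; [exact HU|]; split; [exact HxU|].
          intros y Hy HyB; apply Hno'; exists y; auto. }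
        destruct Hn as (U & HU & HxU & HUB).
        assert (HUm : metric_topology R X d U) by (rewrite top; exact HU).
        destruct (proj2 HUm x HxU) as (e & He & Hball).
        exists e; split; [exact He|]; intros y Hy Hlt.
        apply HD; split; [exact Hy|]; intro Hyc; apply Hc in Hyc.
        destruct (proj2 (proj2 Hyc) U HU (Hball y Hy Hlt)) as (z & Hz & HzB).
        exact (HUB z Hz HzB).
      * intro x; rewrite HD, <- (E B c Hc); unfold elts; tauto.
    + exact (support_nowhere_dense hV G tau hG C hCB hCcov sep eff B HB).
  - exists x0, U0; rewrite top; split; [exact HU0|]; split; [exact Hx0|].
    intros x Hx; destruct (HU0sub x Hx) as [HxX Hiso].
    assert (Hg : exists g, isotropy G x g /\ g <> x).
    { apply NNPP; intro Hno; apply Hiso; intro g; split.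
      - intro Hg; apply NNPP; intro Hne; apply Hno; exists g; auto.
      - intros ->; split; [exact (unit_arr hg HxX)|].
        split; [exact (rng_unit hg HxX)|exact (src_unit hg HxX)]. }
    destruct Hg as (g & Hg & Hne).
    destruct (hCcov g (proj1 Hg)) as (B & HB & HgB).
    destruct (HFex B HB) as (c & HcF & Hc).
    exists c; split; [exact HcF|]; apply Hc; split; [exact HxX|].
    split; [exact HxX|]; intros U _ HxU; exists x; split; [exact HxU|].
    exists g; auto.
Qed.

(** * Disjoint locally closed pieces *)

Section Pieces.
Context {V : membership_structure} (hV : ZF V).
Implicit Types (X t C S U W c e m n w x y z : V).

Definition locally_closed t S : Prop :=
  forall x, x ∈ S -> exists U, U ∈ t /\ x ∈ U /\
    forall y, y ∈ U -> ~ y ∈ S ->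
      exists W, W ∈ t /\ y ∈ W /\ forall z, z ∈ W -> ~ z ∈ S.

(** Induction on [n]: only finitely many members of [C] are numbered below
    [n], although finiteness is never mentioned. *)
Lemma avoid_earlier X t C w f x : is_topology (elts X) (elts t) ->
  is_omega w -> injective_on f (elts C) ->
  (forall c, c ∈ C -> is_closed (elts X) (elts t) (elts c)) -> x ∈ X ->
  forall n, n ∈ w ->
    (forall c m, c ∈ C -> m ∈ n -> pair_in f c m -> ~ x ∈ c) ->
    exists U, U ∈ t /\ x ∈ U /\
      forall c m, c ∈ C -> m ∈ n -> pair_in f c m ->
        forall y, y ∈ U -> ~ y ∈ c.
Proof.
  intros top Hw Hinj Hcl Hx.
  refine (omega_ind hV w Hw _ _ _ _); [definability| |].
  - intros n _ He _; destruct (open_whole top) as (U & HU & HUX).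
    exists U; split; [exact HU|]; split; [apply HUX, Hx|].
    intros c m _ Hm; destruct (He m Hm).
  - intros n n' Hn Hn' Hs IH Hav.
    destruct IH as (U & HU & HxU & HUav).
    { intros c m Hc Hm; apply Hav; [exact Hc|]; apply Hs; auto. }
    destruct (classic (exists c, c ∈ C /\ pair_in f c n))
      as [(c & Hc & Hcn) | Hno].
    + destruct (proj2 (Hcl c Hc)) as (W & HW & HWc).
      destruct (open_inter top HU HW) as (I & HI & HIe).
      exists I; split; [exact HI|]; split.
      * apply HIe; split; [exact HxU|]; apply HWc; split; [exact Hx|].
        apply (Hav c n Hc); [apply Hs; auto|exact Hcn].
      * intros c' m Hc' Hm Hcm y Hy; apply HIe in Hy; destruct Hy as [HyU HyW].
        apply Hs in Hm; destruct Hm as [Hm | ->].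
        -- exact (HUav c' m Hc' Hm Hcm y HyU).
        -- rewrite (Hinj c' c n Hc' Hc Hcm Hcn); apply HWc in HyW; tauto.
    + exists U; split; [exact HU|]; split; [exact HxU|].
      intros c m Hc Hm Hcm; apply Hs in Hm; destruct Hm as [Hm | ->].
      * exact (HUav c m Hc Hm Hcm).
      * destruct Hno; exists c; auto.
Qed.

(** The piece of a closed set [c] consists of the points of [c] that lie in no
    closed set with a smaller number.  The empty set is put among the closed
    sets beforehand; its piece will contribute the unit space to the cover of
    the groupoid built from the pieces. *)
Lemma locally_closed_pieces X t C : is_topology (elts X) (elts t) ->
  countable C ->
  (forall c, c ∈ C -> is_closed (elts X) (elts t) (elts c) /\
                      has_empty_interior (elts t) (elts c)) ->
  exists Sig, countable Sig /\
    (exists e, e ∈ Sig /\ is_empty e) /\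
    (forall S x, S ∈ Sig -> x ∈ S -> x ∈ X) /\
    (forall S, S ∈ Sig -> locally_closed t S) /\
    (forall S, S ∈ Sig -> has_empty_interior (elts t) (elts S)) /\
    (forall S S' x, S ∈ Sig -> S' ∈ Sig -> x ∈ S -> x ∈ S' -> S = S') /\
    (forall x, big_union C x -> big_union Sig x).
Proof.
  intros top HC0 HCcl0.
  destruct (separation hV (fun _ => False) X) as [e0 He0]; [definability|].
  assert (E0 : is_empty e0) by (intros z Hz; apply He0 in Hz; tauto).
  destruct (countable_insert hV e0 C HC0) as (C' & HC' & HC'e).
  assert (Hcl : forall c, c ∈ C' -> is_closed (elts X) (elts t) (elts c)).
  { intros c Hc; apply HC'e in Hc; destruct Hc as [Hc | ->];
      [exact (proj1 (HCcl0 c Hc))|].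
    split; [intros x Hx; destruct (E0 x Hx)|].
    destruct (open_whole top) as (U & HU & HUX); exists U; split; [exact HU|].
    intro x; rewrite HUX; pose proof (E0 x); unfold elts; tauto. }
  assert (Hei : forall c, c ∈ C' -> has_empty_interior (elts t) (elts c)).
  { intros c Hc; apply HC'e in Hc; destruct Hc as [Hc | ->];
      [exact (proj2 (HCcl0 c Hc))|].
    intros (x & U & _ & Hx & HU); exact (E0 x (HU x Hx)). }
  pose proof HC' as (w & f & Hw & Hf & Hinj).
  pose (P := fun c x => x ∈ c /\ forall c' n m, c' ∈ C' -> pair_in f c n ->
               pair_in f c' m -> m ∈ n -> ~ x ∈ c').
  assert (DP : definable_rel P) by (unfold P; definability).
  destruct (countable_family hV P C' X DP HC') as (Sig & HSig & HSe & HSex).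
  exists Sig; split; [exact HSig|].
  split; [|split; [|split; [|split; [|split]]]].
  - destruct (HSex e0) as (e & He & Hee); [apply HC'e; auto|].
    exists e; split; [exact He|]; intros x Hx; apply Hee in Hx.
    exact (E0 x (proj1 (proj2 Hx))).
  - intros S x HS Hx; apply HSe in HS; destruct HS as (c & _ & HS).
    apply HS, Hx.
  - intros S HS; apply HSe in HS; destruct HS as (c & Hc & HS).
    intros x Hx; apply HS in Hx; destruct Hx as (HxX & Hxc & Hxn).
    destruct (function_value _ _ _ _ Hf Hc) as (n & Hn & Hcn).
    destruct (avoid_earlier X t C' w f x top Hw Hinj Hcl HxX n Hn)
      as (U & HU & HxU & HUav).
    { intros c' m Hc' Hm Hcm; exact (Hxn c' n m Hc' Hcn Hcm Hm). }
    exists U; split; [exact HU|]; split; [exact HxU|]; intros y Hy HyS.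
    pose proof (open_sub top HU Hy) as HyX.
    assert (Hyc : ~ y ∈ c).
    { intro Hyc; apply HyS, HS; split; [exact HyX|]; split; [exact Hyc|].
      intros c' n' m Hc' Hn' Hm Hmn.
      rewrite (function_unique _ _ _ _ _ _ Hf Hn' Hcn) in Hmn.
      exact (HUav c' m Hc' Hmn Hm y Hy). }
    destruct (proj2 (Hcl c Hc)) as (W & HW & HWc).
    exists W; split; [exact HW|]; split; [apply HWc; split; assumption|].
    intros z HzW HzS; apply HWc in HzW; apply HS in HzS.
    exact (proj2 HzW (proj1 (proj2 HzS))).
  - intros S HS (x & U & HU & Hx & HUS).
    apply HSe in HS; destruct HS as (c & Hc & HS).
    apply (Hei c Hc); exists x, U; split; [exact HU|]; split; [exact Hx|].
    intros y Hy; exact (proj1 (proj2 (proj1 (HS y) (HUS y Hy)))).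
  - intros S S' x HS HS' Hx Hx'.
    apply HSe in HS; destruct HS as (c & Hc & HS).
    apply HSe in HS'; destruct HS' as (c' & Hc' & HS').
    apply HS in Hx; apply HS' in Hx'.
    destruct Hx as (_ & Hxc & Hxm), Hx' as (_ & Hxc' & Hxm').
    destruct (function_value _ _ _ _ Hf Hc) as (n & Hn & Hcn).
    destruct (function_value _ _ _ _ Hf Hc') as (n' & Hn' & Hcn').
    assert (c = c').
    { destruct (omega_trichotomy hV w Hw n Hn n' Hn') as [H | [-> | H]].
      - destruct (Hxm c' n n' Hc' Hcn Hcn' H Hxc').
      - exact (Hinj c c' n Hc Hc' Hcn Hcn').
      - destruct (Hxm' c n' n Hc Hcn' Hcn H Hxc). }
    subst c'; apply (set_ext hV); intro z; rewrite (HS z), (HS' z); tauto.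
  - intros x (c0 & Hc0 & Hxc0).
    assert (HxX : x ∈ X) by (apply (proj1 (HCcl0 c0 Hc0)); exact Hxc0).
    assert (D : definable_class
      (fun n => exists c, c ∈ C' /\ pair_in f c n /\ x ∈ c)) by definability.
    destruct (omega_least hV w Hw _ D)
      as (n & (Hn & (c & Hc & Hcn & Hxc) & Hmin) & _).
    { assert (Hc0' : c0 ∈ C') by (apply HC'e; auto).
      destruct (function_value _ _ _ _ Hf Hc0') as (n & Hn & Hcn).
      exists n; split; [exact Hn|]; exists c0; auto. }
    destruct (HSex c Hc) as (S & HSS & HS).
    exists S; split; [exact HSS|]; apply HS; split; [exact HxX|].
    split; [exact Hxc|]; intros c' n' m Hc' Hn' Hm Hmn Hxc'.
    rewrite (function_unique _ _ _ _ _ _ Hf Hn' Hcn) in Hmn.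
    apply (Hmin m Hmn); exists c'; auto.
Qed.

End Pieces.

(** * The groupoid of a family of pieces *)

Section Doubling.
Context {V : membership_structure} (hV : ZF V).
Implicit Types (g h k p x y z S U W e : V).
Variables (X t Sig : V) (top : is_topology (elts X) (elts t)).
Hypothesis pieces_countable : countable Sig.
Hypothesis pieces_empty : exists e, e ∈ Sig /\ is_empty e.
Hypothesis pieces_sub : forall S x, S ∈ Sig -> x ∈ S -> x ∈ X.
Hypothesis pieces_locally_closed : forall S, S ∈ Sig -> locally_closed t S.
Hypothesis pieces_meagre :
  forall S, S ∈ Sig -> has_empty_interior (elts t) (elts S).
Hypothesis pieces_disjoint : forall S S' x,
  S ∈ Sig -> S' ∈ Sig -> x ∈ S -> x ∈ S' -> S = S'.

(** [g] is the non-trivial element of the isotropy group at [x], a group of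
    order two.  Coding it as the pair [(x, X)] keeps it out of [X], by
    foundation. *)
Definition twist g x : Prop := big_union Sig x /\ is_pair g x X.

Definition base g x : Prop := x ∈ X /\ (g = x \/ twist g x).

(** The fibre over [x] is [{x}] or a group of order two with neutral element
    [x]; hence a product is neutral when both factors or none are. *)
Definition mul g h k : Prop := exists x,
  base g x /\ base h x /\ base k x /\ (k ∈ X <-> (g ∈ X <-> h ∈ X)).

Lemma twist_not_unit g x : twist g x -> ~ g ∈ X.
Proof. intros [_ H]; exact (pair_not_in hV _ _ _ H). Qed.

Lemma base_twist_intro S g x : S ∈ Sig -> x ∈ S -> is_pair g x X -> base g x.
Proof.
  intros HS Hx Hg; split; [exact (pieces_sub S x HS Hx)|].
  right; split; [exists S; auto|exact Hg].
Qed.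

Lemma base_unit x : x ∈ X -> base x x.
Proof. intro Hx; split; auto. Qed.

Lemma unit_of_base g x : base g x -> g ∈ X -> g = x.
Proof.
  intros [Hx [E | H]] Hg; [exact E|destruct (twist_not_unit _ _ H Hg)].
Qed.

Lemma twist_of_base g x : base g x -> ~ g ∈ X -> twist g x.
Proof. intros [Hx [-> | H]] Hg; [contradiction|exact H]. Qed.

Lemma base_unique g x y : base g x -> base g y -> x = y.
Proof.
  intros Hx Hy; destruct (classic (g ∈ X)) as [H | H].
  - rewrite <- (unit_of_base g x Hx H); exact (unit_of_base g y Hy H).
  - destruct (twist_of_base g x Hx H) as [_ Hgx].
    destruct (twist_of_base g y Hy H) as [_ Hgy].
    exact (proj1 (pair_inj _ _ _ _ _ Hgx Hgy)).
Qed.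

Lemma fibre_ext g h x : base g x -> base h x -> (g ∈ X <-> h ∈ X) -> g = h.
Proof.
  intros Hg Hh E; destruct (classic (g ∈ X)) as [H | H].
  - rewrite (unit_of_base g x Hg H); symmetry; apply unit_of_base; tauto.
  - destruct (twist_of_base g x Hg H) as [_ Hgx].
    destruct (twist_of_base h x Hh) as [_ Hhx]; [tauto|].
    exact (pair_ext hV _ _ _ _ Hgx Hhx).
Qed.

Lemma mul_value g h x : base g x -> base h x -> exists k, mul g h k.
Proof.
  intros Hg Hh.
  assert (Hx : x ∈ X) by apply Hg.
  destruct (classic (g ∈ X)) as [H | H]; [|destruct (classic (h ∈ X)) as [H' | H']].
  - exists h, x; tauto.
  - exists g, x; tauto.
  - exists x, x; pose proof (base_unit x Hx); tauto.
Qed.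

Lemma mul_base g h k x : mul g h k -> base g x ->
  base h x /\ base k x /\ (k ∈ X <-> (g ∈ X <-> h ∈ X)).
Proof.
  intros (y & Hg & H) Hx; rewrite (base_unique g x y Hx Hg); exact H.
Qed.

Variables (E rg cp iv : V).
Hypothesis arrows : forall g, g ∈ E <-> exists x, base g x.
Hypothesis rg_sub : forall p, p ∈ rg -> prod_class (elts E) (elts X) p.
Hypothesis rg_graph : forall g x, pair_in rg g x <-> base g x.
Hypothesis iv_sub : forall p, p ∈ iv -> prod_class (elts E) (elts E) p.
Hypothesis iv_graph : forall g h, pair_in iv g h <-> g ∈ E /\ g = h.
Hypothesis cp_sub : forall p, p ∈ cp ->
  exists q g h k, is_pair p q k /\ is_pair q g h /\ k ∈ E /\ mul g h k.
Hypothesis cp_graph : forall g h k, pair_in2 cp g h k <-> mul g h k.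

Let G := GroupoidData E X rg rg cp iv.

Lemma arrow_intro g x : base g x -> g ∈ E.
Proof. intro H; apply arrows; exists x; exact H. Qed.

Lemma doubling_groupoid : is_groupoid G.
Proof.
  assert (Hrg : is_fun rg (elts E) (elts X)).
  { split; [exact rg_sub|]; intros g Hg; apply arrows in Hg.
    destruct Hg as [x Hx]; exists x; split; [apply rg_graph, Hx|].
    intros y Hy; apply rg_graph in Hy; exact (base_unique g x y Hx Hy). }
  split; cbn [arr unit_space rng src comp inv G].
  - intros x Hx; exact (arrow_intro x x (base_unit x Hx)).
  - exact Hrg.
  - exact Hrg.
  - split.
    + intros p Hp; destruct (cp_sub p Hp) as (q & g & h & k & Hpq & Hq & Hk & Hm).
      exists q, k; split; [|auto]; destruct Hm as (x & Hg & Hh & _).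
      exists g, h, x; cbn; rewrite !rg_graph.
      repeat split; try assumption; try apply Hg; try apply Hh;
        [exact (arrow_intro g x Hg)|exact (arrow_intro h x Hh)].
    + intros q (g & h & x & _ & _ & Hq & Hg & Hh); cbn in Hg, Hh.
      apply rg_graph in Hg, Hh; destruct (mul_value g h x Hg Hh) as [k Hk].
      exists k; split; [apply (pair_in2_iff hV _ _ _ _ _ Hq), cp_graph, Hk|].
      intros k' Hk'; apply (pair_in2_iff hV _ _ _ _ _ Hq), cp_graph in Hk'.
      pose proof (mul_base g h k x Hk Hg); pose proof (mul_base g h k' x Hk' Hg).
      apply (fibre_ext k k' x); tauto.
  - split; [exact iv_sub|]; intros g Hg; exists g; split.
    + apply iv_graph; auto.
    + intros h Hh; apply iv_graph in Hh; tauto.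
  - intros x Hx; apply rg_graph, base_unit, Hx.
  - intros x Hx; apply rg_graph, base_unit, Hx.
  - intros g h k x Hk; rewrite !rg_graph; apply cp_graph in Hk.
    intro Hg; exact (proj1 (proj2 (mul_base g h k x Hk Hg))).
  - intros g h k x Hk; rewrite !rg_graph; apply cp_graph in Hk.
    destruct Hk as (y & _ & Hh & Hk & _); intro Hx.
    rewrite (base_unique h x y Hx Hh); exact Hk.
  - intros g h k gh hk l; rewrite !cp_graph; intros H1 H2 H3.
    destruct H1 as (x & Hg & Hh & Hgh & H1).
    destruct (mul_base _ _ _ x H2 Hgh) as (Hk & Hl & H2').
    destruct (mul_base _ _ _ x H3 Hh) as (_ & Hhk & H3').
    exists x; repeat (split; [assumption|]).
    destruct (classic (g ∈ X)), (classic (h ∈ X)), (classic (k ∈ X)); tauto.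
  - intros g x; rewrite rg_graph, cp_graph; intro Hg; exists x.
    assert (Hx : x ∈ X) by apply Hg; pose proof (base_unit x Hx); tauto.
  - intros g x; rewrite rg_graph, cp_graph; intro Hg; exists x.
    assert (Hx : x ∈ X) by apply Hg; pose proof (base_unit x Hx); tauto.
  - intros g h x; rewrite iv_graph; intros [_ ->]; auto.
  - intros g h x; rewrite iv_graph; intros [_ ->]; auto.
  - intros g h x; rewrite iv_graph, rg_graph, cp_graph; intros [_ ->] Hg.
    exists x; assert (Hx : x ∈ X) by apply Hg; pose proof (base_unit x Hx); tauto.
  - intros g h x; rewrite iv_graph, rg_graph, cp_graph; intros [_ ->] Hg.
    exists x; assert (Hx : x ∈ X) by apply Hg; pose proof (base_unit x Hx); tauto.
Qed.

(** Near a non-trivial element over a point of the piece [S], the sheet of an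
    open set runs through the non-trivial elements over [S] and through the
    units elsewhere.  The square of such a sheet consists of units, which makes
    composition continuous. *)
Definition sheeted W : Prop :=
  (forall g, g ∈ W -> g ∈ E) /\
  (forall x, x ∈ W -> x ∈ X ->
     exists U, U ∈ t /\ x ∈ U /\ forall y, y ∈ U -> y ∈ W) /\
  (forall g x S, g ∈ W -> S ∈ Sig -> x ∈ S -> is_pair g x X ->
     exists U, U ∈ t /\ x ∈ U /\ forall y, y ∈ U ->
       (y ∈ S -> exists h, h ∈ W /\ is_pair h y X) /\ (~ y ∈ S -> y ∈ W)).

Variable tau : V.
Hypothesis tau_opens : forall W, W ∈ tau <-> sheeted W.

Lemma doubling_topology : is_topology (elts E) (elts tau).
Proof.
  split.
  - intros W HW; apply tau_opens in HW; exact (proj1 HW).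
  - destruct (open_whole top) as (U & HU & HUX); unfold elts in HUX.
    exists E; split; [|intro; unfold elts; tauto].
    apply tau_opens; split; [auto|]; split.
    + intros x _ Hx; exists U; split; [exact HU|]; split; [apply HUX, Hx|].
      intros y Hy; apply (arrow_intro y y), base_unit, HUX, Hy.
    + intros g x S _ HS Hx _; exists U; split; [exact HU|].
      split; [apply HUX, (pieces_sub S x HS Hx)|]; intros y Hy; split.
      * intro HyS; destruct (pair_exists hV y X) as [h Hh].
        exists h; split; [|exact Hh].
        exact (arrow_intro h y (base_twist_intro S h y HS HyS Hh)).
      * intros _; apply (arrow_intro y y), base_unit, HUX, Hy.
  - intros W W' HW HW'; apply tau_opens in HW, HW'.
    destruct HW as (W1 & W2 & W3), HW' as (W1' & W2' & W3').
    destruct (separation hV (fun x => x ∈ W') W) as [I HI]; [definability|].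
    exists I; split; [|exact HI]; apply tau_opens; split; [|split].
    + intros g Hg; apply W1, HI, Hg.
    + intros x Hx HxX; apply HI in Hx; destruct Hx as [Hx Hx'].
      destruct (W2 x Hx HxX) as (U & HU & HxU & HUW).
      destruct (W2' x Hx' HxX) as (U' & HU' & HxU' & HUW').
      destruct (open_inter top HU HU') as (J & HJ & HJe).
      exists J; split; [exact HJ|]; split; [apply HJe; auto|].
      intros y Hy; apply HJe in Hy; apply HI; split; [apply HUW|apply HUW'];
        tauto.
    + intros g x S Hg HS Hx Hgx; apply HI in Hg; destruct Hg as [Hg Hg'].
      destruct (W3 g x S Hg HS Hx Hgx) as (U & HU & HxU & HUW).
      destruct (W3' g x S Hg' HS Hx Hgx) as (U' & HU' & HxU' & HUW').
      destruct (open_inter top HU HU') as (J & HJ & HJe).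
      exists J; split; [exact HJ|]; split; [apply HJe; auto|].
      intros y Hy; apply HJe in Hy; destruct Hy as [Hy Hy'].
      destruct (HUW y Hy) as [H1 H2], (HUW' y Hy') as [H1' H2']; split.
      * intro HyS; destruct (H1 HyS) as (h & Hh & Hhy).
        destruct (H1' HyS) as (h' & Hh' & Hhy').
        rewrite (pair_ext hV _ _ _ _ Hhy' Hhy) in Hh'.
        exists h; split; [apply HI; auto|exact Hhy].
      * intro HyS; apply HI; auto.
  - intros F HF; destruct (zf_union hV F) as [W HW].
    exists W; split; [|exact HW].
    assert (HF' : forall A, A ∈ F -> sheeted A)
      by (intros A HA; apply tau_opens, HF, HA).
    apply tau_opens; split; [|split].
    + intros g Hg; apply HW in Hg; destruct Hg as (A & HA & Hg).
      exact (proj1 (HF' A HA) g Hg).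
    + intros x Hx HxX; apply HW in Hx; destruct Hx as (A & HA & Hx).
      destruct (proj1 (proj2 (HF' A HA)) x Hx HxX) as (U & HU & HxU & HUA).
      exists U; split; [exact HU|]; split; [exact HxU|].
      intros y Hy; apply HW; exists A; auto.
    + intros g x S Hg HS Hx Hgx; apply HW in Hg; destruct Hg as (A & HA & Hg).
      destruct (proj2 (proj2 (HF' A HA)) g x S Hg HS Hx Hgx)
        as (U & HU & HxU & HUA).
      exists U; split; [exact HU|]; split; [exact HxU|].
      intros y Hy; destruct (HUA y Hy) as [H1 H2]; split.
      * intro HyS; destruct (H1 HyS) as (h & Hh & Hhy).
        exists h; split; [apply HW; exists A; auto|exact Hhy].
      * intro HyS; apply HW; exists A; auto.
Qed.

Lemma unit_not_pair x y : x ∈ X -> ~ is_pair x y X.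
Proof. intros Hx H; exact (pair_not_in hV _ _ _ H Hx). Qed.

Lemma open_units_in_tau U : U ∈ t -> U ∈ tau.
Proof.
  intro HU; pose proof (open_sub top HU) as HUX; unfold elts in HUX.
  apply tau_opens; split; [|split].
  - intros x Hx; exact (arrow_intro x x (base_unit x (HUX x Hx))).
  - intros x Hx _; exists U; auto.
  - intros g x S Hg _ _ Hgx; destruct (unit_not_pair g x (HUX g Hg) Hgx).
Qed.

Lemma units_in_t : X ∈ t.
Proof.
  destruct (open_whole top) as (U & HU & HUX).
  replace X with U; [exact HU|apply (set_ext hV); exact HUX].
Qed.

Lemma trace_open W : W ∈ tau ->
  exists U, U ∈ t /\ forall x, x ∈ U <-> x ∈ W /\ x ∈ X.
Proof.
  intro HW; apply tau_opens in HW; destruct HW as (_ & HW & _).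
  destruct (separation hV (fun x => x ∈ X) W) as [U HU]; [definability|].
  exists U; split; [|exact HU]; apply (open_of_local hV X t U top).
  intros x Hx; apply HU in Hx; destruct Hx as [Hx HxX].
  destruct (HW x Hx HxX) as (O & HO & HxO & HOW).
  exists O; split; [exact HO|]; split; [exact HxO|].
  intros y Hy; apply HU; split; [auto|exact (open_sub top HO Hy)].
Qed.

Lemma preimage_open U : U ∈ t ->
  exists W, W ∈ tau /\ forall g, g ∈ W <-> exists x, x ∈ U /\ base g x.
Proof.
  intro HU; pose proof (open_sub top HU) as HUX; unfold elts in HUX.
  assert (D : definable_class (fun g => exists x, x ∈ U /\ base g x))
    by definability.
  destruct (separation hV _ E D) as [W HW].
  assert (HW' : forall g, g ∈ W <-> exists x, x ∈ U /\ base g x).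
  { intro g; rewrite HW; split; [tauto|]; intros (x & Hx & Hg).
    split; [exact (arrow_intro g x Hg)|exists x; auto]. }
  exists W; split; [|exact HW']; apply tau_opens; split; [|split].
  - intros g Hg; apply HW, Hg.
  - intros x Hx HxX; apply HW' in Hx; destruct Hx as (y & Hy & Hxy).
    rewrite (unit_of_base x y Hxy HxX).
    exists U; split; [exact HU|]; split; [exact Hy|].
    intros z Hz; apply HW'; exists z; split; [exact Hz|].
    apply base_unit, HUX, Hz.
  - intros g x S Hg HS Hx Hgx; apply HW' in Hg; destruct Hg as (y & Hy & Hgy).
    rewrite (base_unique g y x Hgy (base_twist_intro S g x HS Hx Hgx)) in Hy.
    exists U; split; [exact HU|]; split; [exact Hy|]; intros z Hz; split.
    + intro HzS; destruct (pair_exists hV z X) as [h Hh]; exists h.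
      split; [apply HW'; exists z; split; [exact Hz|]|exact Hh].
      exact (base_twist_intro S h z HS HzS Hh).
    + intros _; apply HW'; exists z; split; [exact Hz|].
      apply base_unit, HUX, Hz.
Qed.

Lemma range_open W : W ∈ tau ->
  exists U, U ∈ t /\ forall x, x ∈ U <-> exists g, g ∈ W /\ base g x.
Proof.
  intro HW; apply tau_opens in HW; destruct HW as (W1 & W2 & W3).
  assert (D : definable_class (fun x => exists g, g ∈ W /\ base g x))
    by definability.
  destruct (separation hV _ X D) as [U HU].
  assert (HU' : forall x, x ∈ U <-> exists g, g ∈ W /\ base g x).
  { intro x; rewrite HU; split; [tauto|]; intros (g & Hg & Hgx).
    split; [apply Hgx|exists g; auto]. }
  exists U; split; [|exact HU']; apply (open_of_local hV X t U top).
  intros x Hx; apply HU' in Hx; destruct Hx as (g & Hg & Hgx).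
  destruct (classic (g ∈ X)) as [HgX | HgX].
  - pose proof (unit_of_base g x Hgx HgX); subst g.
    destruct (W2 x Hg HgX) as (O & HO & HxO & HOW).
    exists O; split; [exact HO|]; split; [exact HxO|].
    intros y Hy; apply HU'; exists y; split; [auto|].
    apply base_unit, (open_sub top HO Hy).
  - destruct (twist_of_base g x Hgx HgX) as [(S & HS & Hx) Hgp].
    destruct (W3 g x S Hg HS Hx Hgp) as (O & HO & HxO & HOW).
    exists O; split; [exact HO|]; split; [exact HxO|].
    intros y Hy; apply HU'; destruct (HOW y Hy) as [H1 H2].
    destruct (classic (y ∈ S)) as [HyS | HyS].
    + destruct (H1 HyS) as (h & Hh & Hhy).
      exists h; split; [exact Hh|exact (base_twist_intro S h y HS HyS Hhy)].
    + exists y; split; [auto|]; apply base_unit, (open_sub top HO Hy).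
Qed.

(** The section of the groupoid that is non-trivial over [S] and trivial
    elsewhere; outside [S] it is cut down to the points not adherent to [S],
    so as to be open. *)
Definition section_over S g : Prop :=
  (exists x, x ∈ S /\ is_pair g x X) \/
  (g ∈ X /\ exists U, U ∈ t /\ g ∈ U /\ forall y, y ∈ U -> ~ y ∈ S).

Lemma section_over_arrow S g : S ∈ Sig -> section_over S g -> g ∈ E.
Proof.
  intros HS [(x & Hx & Hg) | [Hg _]].
  - exact (arrow_intro g x (base_twist_intro S g x HS Hx Hg)).
  - exact (arrow_intro g g (base_unit g Hg)).
Qed.

Lemma section_over_injective S g h x : S ∈ Sig ->
  section_over S g -> section_over S h -> base g x -> base h x -> g = h.
Proof.
  intros HS Hg Hh Hgx Hhx; apply (fibre_ext g h x Hgx Hhx).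
  assert (L : forall k, section_over S k -> base k x -> (k ∈ X <-> ~ x ∈ S)).
  { intros k [(y & Hy & Hk) | (Hk & U & _ & HkU & HUS)] Hkx.
    - rewrite (base_unique k x y Hkx (base_twist_intro S k y HS Hy Hk)).
      split; [intro HkX; destruct (unit_not_pair k y HkX Hk)|tauto].
    - pose proof (unit_of_base k x Hkx Hk); subst k; split; auto. }
  rewrite (L g Hg Hgx), (L h Hh Hhx); tauto.
Qed.

Lemma section_over_open S B : S ∈ Sig ->
  (forall g, g ∈ B <-> section_over S g) -> B ∈ tau.
Proof.
  intros HS HB; apply tau_opens; split; [|split].
  - intros g Hg; exact (section_over_arrow S g HS (proj1 (HB g) Hg)).
  - intros x Hx HxX; apply HB in Hx.
    destruct Hx as [(y & _ & Hp) | (_ & U & HU & HxU & HUS)];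
      [destruct (unit_not_pair x y HxX Hp)|].
    exists U; split; [exact HU|]; split; [exact HxU|].
    intros y Hy; apply HB; right; split; [exact (open_sub top HU Hy)|].
    exists U; auto.
  - intros g x S' Hg HS' Hx Hgx; apply HB in Hg.
    destruct Hg as [(y & Hy & Hgy) | [Hg _]];
      [|destruct (unit_not_pair g x Hg Hgx)].
    destruct (pair_inj _ _ _ _ _ Hgx Hgy) as [<- _].
    pose proof (pieces_disjoint S' S x HS' HS Hx Hy); subst S'.
    destruct (pieces_locally_closed S HS x Hy) as (U & HU & HxU & HUS).
    exists U; split; [exact HU|]; split; [exact HxU|]; intros z Hz; split.
    + intro HzS; destruct (pair_exists hV z X) as [h Hh].
      exists h; split; [apply HB; left; exists z; auto|exact Hh].
    + intro HzS; apply HB; right; split; [exact (open_sub top HU Hz)|auto].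
Qed.

Lemma section_over_exists S : S ∈ Sig ->
  exists B, B ∈ tau /\ forall g, g ∈ B <-> section_over S g.
Proof.
  intro HS.
  assert (D : definable_class (section_over S)) by definability.
  destruct (separation hV _ E D) as [B HB].
  assert (HB' : forall g, g ∈ B <-> section_over S g).
  { intro g; rewrite HB; split; [tauto|].
    intro H; split; [exact (section_over_arrow S g HS H)|exact H]. }
  exists B; split; [exact (section_over_open S B HS HB')|exact HB'].
Qed.

(** The only case that uses the sections over pieces is that of two
    non-trivial factors: they coincide, and so do any two composable elements
    of a section containing them. *)
Lemma mul_continuous g h k W : W ∈ tau -> mul g h k -> k ∈ W ->
  exists U U', U ∈ tau /\ U' ∈ tau /\ g ∈ U /\ h ∈ U' /\
    forall a b c, a ∈ U -> b ∈ U' -> mul a b c -> c ∈ W.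
Proof.
  intros HW (x & Hg & Hh & Hk & Hu) HkW.
  pose proof (open_units_in_tau X units_in_t) as HX.
  destruct (classic (g ∈ X)) as [HgX | HgX];
    [|destruct (classic (h ∈ X)) as [HhX | HhX]].
  - exists X, W; repeat (split; [assumption|]); split.
    + rewrite (fibre_ext h k x Hh Hk); tauto.
    + intros a b c Ha Hb (y & _ & Hby & Hcy & H).
      rewrite (fibre_ext c b y Hcy Hby); tauto.
  - exists W, X; repeat (split; [assumption|]); split.
    + rewrite (fibre_ext g k x Hg Hk); tauto.
    + split; [assumption|]; intros a b c Ha Hb (y & Hay & _ & Hcy & H).
      rewrite (fibre_ext c a y Hcy Hay); tauto.
  - destruct (twist_of_base g x Hg HgX) as [(S & HS & Hx) Hgp].
    assert (E' : g = h) by (apply (fibre_ext g h x Hg Hh); tauto); subst h.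
    assert (HkX : k ∈ X) by tauto.
    pose proof (unit_of_base k x Hk HkX); subst k.
    destruct (section_over_exists S HS) as (B & HB & HBe).
    destruct (trace_open W HW) as (O & HO & HOe).
    destruct (preimage_open O HO) as (P & HP & HPe).
    destruct (open_inter doubling_topology HB HP) as (I & HI & HIe).
    assert (HgI : g ∈ I).
    { apply HIe; split; [apply HBe; left; exists x; auto|].
      apply HPe; exists x; split; [apply HOe; auto|exact Hg]. }
    exists I, I; repeat (split; [assumption|]).
    intros a b c Ha Hb (y & Hay & Hby & Hcy & H).
    apply HIe in Ha, Hb; destruct Ha as [HaB HaP], Hb as [HbB _].
    assert (E' : a = b).
    { apply (section_over_injective S a b y HS); auto; apply HBe; assumption. }
    subst b; rewrite (unit_of_base c y Hcy) by tauto.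
    apply HPe in HaP; destruct HaP as (z & HzO & Haz).
    rewrite (base_unique a y z Hay Haz); apply HOe, HzO.
Qed.

Lemma doubling_topological_groupoid : topological_groupoid G tau.
Proof.
  split; [exact doubling_groupoid|exact doubling_topology| |].
  - intros W HW; cbn [arr comp G].
    destruct (product_exists hV E E) as [EE HEE].
    destruct (separation hV (fun p => exists U U' g h,
      U ∈ tau /\ U' ∈ tau /\ is_pair p g h /\ g ∈ U /\ h ∈ U' /\
      forall a b c, a ∈ U -> b ∈ U' -> pair_in2 cp a b c -> c ∈ W) EE)
      as [P HP]; [definability|].
    destruct (separation hV (composable G) P) as [Q HQ];
      [unfold composable; definability|].
    exists Q; split; [exists P; split; [|exact HQ]; split|].
    + intros p Hp; apply HEE, HP, Hp.
    + intros p Hp; apply HP in Hp.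
      destruct Hp as (_ & U & U' & g & h & HU & HU' & Hp & Hg & Hh & Hsub).
      exists U, U'; split; [exact HU|]; split; [exact HU'|]; split;
        [exists g, h; auto|].
      intros q (a & b & Ha & Hb & Hq); apply HP; split.
      * apply HEE; exists a, b.
        pose proof (open_sub doubling_topology HU Ha).
        pose proof (open_sub doubling_topology HU' Hb); auto.
      * exists U, U', a, b; repeat (split; [assumption|]); exact Hsub.
    + intro p; rewrite HQ, HP; split.
      * intros ((_ & U & U' & g & h & HU & HU' & Hp & Hg & Hh & Hsub) & Hc).
        split; [exact Hc|].
        destruct (function_value _ _ _ _ (comp_fun doubling_groupoid) Hc)
          as (k & _ & Hk).
        exists k; split; [|exact Hk]; apply (Hsub g h k Hg Hh).
        exists p; auto.
      * intros (Hc & k & HkW & Hk); split; [|exact Hc].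
        pose proof Hc as (g & h & x & Hg & Hh & Hp & _).
        split; [apply HEE; exists g, h; auto|].
        assert (Hm : mul g h k) by (apply cp_graph; exists p; auto).
        destruct (mul_continuous g h k W HW Hm HkW)
          as (U & U' & HU & HU' & HgU & HhU & Hsub).
        exists U, U', g, h; repeat (split; [assumption|]).
        intros a b c Ha Hb Habc; apply (Hsub a b c Ha Hb), cp_graph, Habc.
  - intros W HW; exists W; split; [exact HW|]; intro g; cbn [arr inv G].
    pose proof (open_sub doubling_topology HW (x := g)) as HgE; split.
    + intro Hg; split; [auto|]; exists g; split; [exact Hg|].
      apply iv_graph; split; [apply HgE, Hg|reflexivity].
    + intros (_ & h & Hh & Hgh); apply iv_graph in Hgh.
      destruct Hgh as [_ ->]; exact Hh.
Qed.

Lemma doubling_unit_topology U : unit_topology G tau U <-> U ∈ t.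
Proof.
  split.
  - intros (W & HW & HWe); destruct (trace_open W HW) as (O & HO & HOe).
    replace U with O; [exact HO|]; apply (set_ext hV); intro x.
    rewrite (HOe x), (HWe x); unfold elts; cbn; tauto.
  - intro HU; exists U; split; [exact (open_units_in_tau U HU)|].
    intro x; pose proof (open_sub top HU (x := x)); unfold elts in *; cbn; tauto.
Qed.

Lemma section_bisection S B : S ∈ Sig ->
  (forall g, g ∈ B <-> section_over S g) -> neighbourhood_bisection G tau (elts B).
Proof.
  intros HS HB.
  pose proof (section_over_open S B HS HB) as HBt.
  pose proof (interior_open (elts tau) B HBt) as HBi.
  assert (Hsub : forall g, g ∈ B -> g ∈ E)
    by (intros g Hg; exact (section_over_arrow S g HS (proj1 (HB g) Hg))).
  assert (Hinj : injective_on rg (elts B)).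
  { intros g h x Hg Hh Hgx Hhx; apply rg_graph in Hgx, Hhx.
    apply (section_over_injective S g h x HS); auto; apply HB; assumption. }
  assert (Himg : forall W, W ∈ tau -> is_open (elts tau) (image rg (elts W))).
  { intros W HW; destruct (range_open W HW) as (U & HU & HUe).
    exists U; split; [exact (open_units_in_tau U HU)|].
    intro x; rewrite HUe; split; intros (g & Hg & Hgx); exists g;
      (split; [exact Hg|]); apply rg_graph; exact Hgx. }
  assert (Hhom : homeo_onto_image rg (elts B) (elts tau) (elts tau)).
  { split; [exact Hinj|]; split.
    - intros U (W & HW & HWe).
      destruct (trace_open W HW) as (O & HO & HOe).
      destruct (preimage_open O HO) as (P & HP & HPe).
      destruct (open_inter doubling_topology HP HBt) as (I & HI & HIe).
      exists I; split; [exists P; auto|].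
      intro g; rewrite HIe, HPe; split.
      + intros [(x & Hx & Hgx) HgB]; split; [exact HgB|].
        exists x; split; [|apply rg_graph, Hgx].
        apply HWe; split; [apply HOe, Hx|]; exists g.
        split; [exact HgB|apply rg_graph, Hgx].
      + intros (HgB & x & Hx & Hgx); split; [|exact HgB].
        apply rg_graph in Hgx; exists x; split; [|exact Hgx].
        apply HOe; split; [apply HWe, Hx|apply Hgx].
    - intros U (W & HW & HWe).
      destruct (open_inter doubling_topology HW HBt) as (I & HI & HIe).
      assert (HUI : U = I).
      { apply (set_ext hV); intro g; rewrite (HWe g), (HIe g); reflexivity. }
      subst I; destruct (Himg U HI) as (O & HO & HOe).
      exists O; split; [|exact HOe]; exists O; split; [exact HO|].
      intro x; split; [|tauto]; intro Hx; split; [exact Hx|].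
      apply HOe in Hx; destruct Hx as (g & Hg & Hgx).
      exists g; split; [apply HIe, Hg|exact Hgx]. }
  split; try rewrite HBi.
  - exact Hsub.
  - intros g Hg; split; [exact (Hsub g Hg)|]; intros U _ HgU; exists g; auto.
  - exact Hinj.
  - exact Hinj.
  - exact (Himg B HBt).
  - exact (Himg B HBt).
  - pose proof (Himg B HBt); split; [exact Hsub|]; split;
      [exists B; split; [exact HBt|intro; reflexivity]|].
    cbn [rng src G]; auto.
  - intros g Hg Hn; contradiction.
Qed.

Lemma doubling_cover : countable_nbhd_bisection_cover G tau.
Proof.
  assert (D : definable_rel section_over) by (unfold section_over; definability).
  destruct (countable_family hV section_over Sig E D pieces_countable)
    as (C & HC & HCe & HCex).
  assert (L : forall S B, S ∈ Sig ->
    (forall g, g ∈ B <-> g ∈ E /\ section_over S g) ->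
    forall g, g ∈ B <-> section_over S g).
  { intros S B HS HB g; rewrite HB; split; [tauto|].
    intro H; split; [exact (section_over_arrow S g HS H)|exact H]. }
  exists C; split; [exact HC|]; split.
  - intros B HB; apply HCe in HB; destruct HB as (S & HS & HB).
    exact (section_bisection S B HS (L S B HS HB)).
  - intros g Hg; cbn in Hg; pose proof Hg as HgE.
    apply arrows in Hg; destruct Hg as [x Hgx].
    destruct (classic (g ∈ X)) as [HgX | HgX].
    + (* the section over the empty piece is the unit space *)
      destruct pieces_empty as (e & He & Hem).
      destruct (HCex e He) as (B & HBC & HB).
      exists B; split; [exact HBC|]; apply HB; split; [exact HgE|].
      right; split; [exact HgX|]; exists X; split; [exact units_in_t|].
      split; [exact HgX|]; intros y _; apply Hem.
    + destruct (twist_of_base g x Hgx HgX) as [(S & HS & Hx) Hgp].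
      destruct (HCex S HS) as (B & HBC & HB).
      exists B; split; [exact HBC|]; apply HB; split; [exact HgE|].
      left; exists x; auto.
Qed.

(** A neighbourhood of a non-trivial element over [S] contains all nearby units
    outside [S]. *)
Lemma doubling_effective : effective G tau.
Proof.
  intros (g & W & HW & HgW & HWsub).
  destruct (HWsub g HgW) as [_ HgX]; cbn in HgX.
  pose proof (proj1 (tau_opens W) HW) as (W1 & _ & W3).
  pose proof (W1 g HgW) as Hg; apply arrows in Hg; destruct Hg as [x Hgx].
  destruct (twist_of_base g x Hgx HgX) as [(S & HS & Hx) Hgp].
  destruct (W3 g x S HgW HS Hx Hgp) as (U & HU & HxU & HUW).
  apply (pieces_meagre S HS); exists x, U.
  split; [exact HU|]; split; [exact HxU|]; intros y Hy.
  apply NNPP; intro HyS; pose proof (proj2 (HUW y Hy) HyS) as HyW.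
  exact (proj2 (HWsub y HyW) (open_sub top HU Hy)).
Qed.

Lemma doubling_isotropy x : big_union Sig x ->
  ~ (forall g, isotropy G x g <-> g = x).
Proof.
  intros (S & HS & Hx) H.
  destruct (pair_exists hV x X) as [g Hg].
  pose proof (base_twist_intro S g x HS Hx Hg) as Hgx.
  apply (unit_not_pair x x (pieces_sub S x HS Hx)).
  replace x with g at 1; [exact Hg|].
  apply H; split; [exact (arrow_intro g x Hgx)|].
  split; apply rg_graph; exact Hgx.
Qed.

End Doubling.

(** All that remains for the groupoid above is that its arrows, structure maps
    and topology are sets, as they are definable subclasses of sets. *)
Lemma doubling_exists (V : membership_structure) (X t Sig : V) : ZF V ->
  is_topology (elts X) (elts t) -> countable Sig ->
  (exists e, e ∈ Sig /\ is_empty e) ->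
  (forall S x, S ∈ Sig -> x ∈ S -> x ∈ X) ->
  (forall S, S ∈ Sig -> locally_closed t S) ->
  (forall S, S ∈ Sig -> has_empty_interior (elts t) (elts S)) ->
  (forall S S' x, S ∈ Sig -> S' ∈ Sig -> x ∈ S -> x ∈ S' -> S = S') ->
  exists (G : groupoid_data V) (tau : V),
    unit_space G = X /\ topological_groupoid G tau /\
    (forall U, unit_topology G tau U <-> U ∈ t) /\
    countable_nbhd_bisection_cover G tau /\ effective G tau /\
    forall x, big_union Sig x -> ~ (forall g, isotropy G x g <-> g = x).
Proof.
  intros hV top HSc HSe HSs HSl HSm HSd.
  destruct (zf_pairing hV X X) as [sX HsX].
  destruct (product_exists hV X sX) as [Q HQ].
  destruct (zf_pairing hV X Q) as [XQ HXQ].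
  destruct (zf_union hV XQ) as [E0 HE0].
  destruct (separation hV (fun g => exists x, base X Sig g x) E0)
    as [E HE]; [unfold base, twist; definability|].
  assert (arrows : forall g, g ∈ E <-> exists x, base X Sig g x).
  { intro g; rewrite HE; split; [tauto|]; intros (x & Hg); split; [|eauto].
    apply HE0; destruct Hg as [Hx [-> | [_ Hg]]].
    - exists X; split; [apply HXQ; auto|exact Hx].
    - exists Q; split; [apply HXQ; auto|]; apply HQ.
      exists x, X; split; [exact Hx|]; split; [apply HsX; auto|exact Hg]. }
  destruct (product_exists hV E E) as [EE HEE].
  destruct (graph_exists hV (base X Sig) E X) as (rg & Hrg & Hrg');
    [unfold base, twist; definability|].
  destruct (graph_exists hV (fun g h => g = h) E E) as (iv & Hiv & Hiv');
    [definability|].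
  destruct (graph_exists hV
    (fun q k => exists g h, is_pair q g h /\ mul X Sig g h k) EE E)
    as (cp & Hcp & Hcp'); [unfold mul, base, twist; definability|].
  destruct (zf_power hV E) as [PE HPE].
  destruct (separation hV (sheeted X t Sig E) PE) as [tau Htau];
    [unfold sheeted; definability|].
  assert (Htau' : forall W, W ∈ tau <-> sheeted X t Sig E W).
  { intro W; rewrite Htau, HPE; split; [tauto|].
    intro H; split; [exact (proj1 H)|exact H]. }
  assert (rg_graph : forall g x, pair_in rg g x <-> base X Sig g x).
  { intros g x; rewrite Hrg'; split; [tauto|]; intro H.
    split; [apply arrows; exists x; exact H|]; split; [apply H|exact H]. }
  assert (iv_graph : forall g h, pair_in iv g h <-> g ∈ E /\ g = h).
  { intros g h; rewrite Hiv'; split; [tauto|]; intros [Hg <-]; auto. }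
  assert (cp_graph : forall g h k, pair_in2 cp g h k <-> mul X Sig g h k).
  { intros g h k; split.
    - intros (q & Hq & Hk); apply Hcp' in Hk.
      destruct Hk as (_ & _ & g' & h' & Hq' & Hm).
      destruct (pair_inj _ _ _ _ _ Hq Hq') as [-> ->]; exact Hm.
    - intro Hm; destruct (pair_exists hV g h) as [q Hq].
      exists q; split; [exact Hq|]; apply Hcp'.
      pose proof Hm as (x & Hg & Hh & Hk & _).
      split; [apply HEE; exists g, h; unfold elts; rewrite !arrows; eauto|].
      split; [apply arrows; eauto|eauto]. }
  assert (cp_sub : forall p, p ∈ cp -> exists q g h k,
    is_pair p q k /\ is_pair q g h /\ k ∈ E /\ mul X Sig g h k).
  { intros p Hp; destruct (Hcp p Hp) as (q & k & _ & Hk & Hpq).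
    assert (H : pair_in cp q k) by (exists p; auto).
    apply Hcp' in H; destruct H as (_ & _ & g & h & Hq & Hm).
    exists q, g, h, k; auto. }
  exists (GroupoidData E X rg rg cp iv), tau.
  split; [reflexivity|]; split; [|split; [|split; [|split]]].
  - eapply doubling_topological_groupoid; eassumption.
  - eapply doubling_unit_topology; eassumption.
  - eapply doubling_cover; eassumption.
  - eapply doubling_effective; eassumption.
  - eapply doubling_isotropy; eassumption.
Qed.

Lemma principal_implies_baire (V : membership_structure) : ZF V ->
  effective_implies_principal V -> baire_category_theorem V.
Proof.
  intros hV Hprin R X d hM C HC HCcl (x & U & HU & HxU & HUC).
  destruct (zf_power hV X) as [PX HPX].
  destruct (separation hV (metric_topology R X d) PX) as [t Ht];
    [definability|].
  assert (Et : metric_topology R X d = elts t).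
  { apply functional_extensionality; intro W.
    apply propositional_extensionality; unfold elts; rewrite Ht, HPX.
    split; [intro H; split; [exact (proj1 H)|exact H]|tauto]. }
  assert (top : is_topology (elts X) (elts t)).
  { rewrite <- Et.
    exact (metric_is_topology hV R (cms_field hM) X d). }
  rewrite Et in *.
  destruct (locally_closed_pieces hV X t C top HC HCcl)
    as (Sig & HSc & HSe & HSs & HSl & HSm & HSd & HSC).
  destruct (doubling_exists V X t Sig hV top HSc HSe HSs HSl HSm HSd)
    as (G & tau & EG & HG & HGt & Hcov & Heff & Hiso).
  refine (Hprin G tau HG _ Hcov Heff _).
  - exists R, d; rewrite EG; split; [exact hM|].
    intro W; rewrite HGt, Et; reflexivity.
  - exists x, U; split; [apply HGt, HU|]; split; [exact HxU|].
    intros y Hy; rewrite EG; split; [exact (open_sub top HU Hy)|].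
    apply Hiso, HSC, HUC, Hy.
Qed.

Theorem theorem4p1 (V : membership_structure) (hV : ZF V) :
  baire_category_theorem V <-> effective_implies_principal V.
Proof.
  split.
  - exact (baire_implies_principal V hV).
  - exact (principal_implies_baire V hV).
Qed.
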